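(* Let $n\in\mathbb N$, let $A$ be an $n\times n$ real matrix all of whose (complex) eigenvalues have positive real parts, and let $G:\mathbb R^n\to\mathbb R^n$, $G\sim\sum_{m\ge2}G_m$, $G_m(x)=\mathcal G_m(x,\dots,x)$, be as in the context. Let $f:(0,\infty)\to\mathbb R^n$ be a function that is continuous on $[T_f,\infty)$ for some $T_f\ge 0$. Let $(\mu_k)_{k=1}^\infty$ be a divergent, strictly increasing sequence of positive numbers such that the set $\mathcal S=\{\mu_k:k\in\mathbb N\}$ satisfies $x+y\in\mathcal S$ for all $x,y\in\mathcal S$ and contains $\operatorname{Re}\sigma(A)=\{\operatorname{Re}\Lambda:\Lambda\text{ is an eigenvalue of }A\}$. Assume that $f$ admits the exponential asymptotic expansion $$f(t)\sim\sum_{k=1}^\infty f_k(t),\qquad f_k\in\mathcal F_E(-\mu_k,\mathbb C^n,\mathbb R^n)\text{ for }k\in\mathbb N.$$ Let $T_0\ge0$ and let $y\in C^1((T_0,\infty),\mathbb R^n)$ be a solution of $y'=-Ay+G(y)+f(t)$ on $(T_0,\infty)$ with $y(t)\to0$ as $t\to\infty$. Then there exist functions $y_k\in\mathcal F_E(-\mu_k,\mathbb C^n,\mathbb R^n)$, $k\in\mathbb N$, such that $y$ admits the exponential asymptotic expansion $$y(t)\sim\sum_{k=1}^\infty y_k(t).$$ Moreover, for each $k\in\mathbb N$, the function $y_k$ solves $$y_k'+Ay_k=\sum_{m\ge2}\ \sum_{\mu_{j_1}+\mu_{j_2}+\cdots+\mu_{j_m}=\mu_k}\mathcal G_m(y_{j_1},y_{j_2},\ldots,y_{j_m})+f_k\quad\text{for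 }t\in\mathbb R.$$
   Context: $|\cdot|$ is the Euclidean norm. $u(t)=\mathcal O(h(t))$ means that there are $T,C>0$ with $|u(t)|\le Ch(t)$ for all $t\ge T$. Assumption on $G$: $G:\mathbb R^n\to\mathbb R^n$ is locally Lipschitz, and there exist functions $G_m:\mathbb R^n\to\mathbb R^n$, $m\ge 2$, each a homogeneous polynomial of degree $m$, such that for any $N\ge2$ there exists $\delta>0$ with $|G(x)-\sum_{m=2}^N G_m(x)|=\mathcal O(|x|^{N+\delta})$ as $x\to0$. For each $m\ge2$, $\mathcal G_m$ is an $m$-linear mapping from $(\mathbb R^n)^m$ to $\mathbb R^n$ with $G_m(x)=\mathcal G_m(x,x,\ldots,x)$ for $x\in\mathbb R^n$. Classes: for $\mu\in\mathbb R$, $\mathcal F_E(\mu,\mathbb C^n)$ is the set of functions $g:\mathbb R\to\mathbb C^n$ of the form $g(t)=\sum_{\lambda\in S}p_\lambda(t)e^{\lambda t}$, where $S$ is a finite subset of $\mathbb C$ with $\operatorname{Re}\lambda=\mu$ for all $\lambda\in S$, and each $p_\lambda$ is a polynomial from $\mathbb R$ to $\mathbb C^n$. $\mathcal F_E(\mu,\mathbb C^n,\mathbb R^n)$ is the set of $g\in\mathcal F_E(\mu,\mathbb C^n)$ with $g(t)\in\mathbb R^n$ for all $t\in\mathbb R$. Exponential asymptotic expansion: for a $\mathbb C^n$-valued function $g$ on $(T,\infty)$ and a divergent, strictly increasing sequence $(\gamma_k)_{k=1}^\infty$ of nonnegative numbers, one writes $g(t)\sim\sum_{k=1}^\infty g_k(t)$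 with $g_k\in\mathcal F_E(-\gamma_k,\mathbb C^n)$ if for any $N\ge1$ there exists $\mu>\gamma_N$ such that $|g(t)-\sum_{k=1}^N g_k(t)|=\mathcal O(e^{-\mu t})$. In the double sum, $m$ ranges over integers $\ge 2$ and $j_1,\ldots,j_m$ over $\mathbb N=\{1,2,\dots\}$ subject to the stated condition; the sum is finite, involves only indices $j_\ell\le k-1$, and is zero if no such indices exist. *)

(* Defs.v *)
From HB Require Import structures.
From mathcomp Require Export all_boot all_order all_algebra.
From mathcomp Require Export all_classical all_reals all_analysis.
From mathcomp Require Export complex.
(* Not imported: its notations clash with those of mathcomp-analysis. *)
From mathcomp Require mpoly.

Export Order.TTheory GRing.Theory Num.Theory.
Export numFieldNormedType.Exports.

Set Implicit Arguments.
Unset Strict Implicit.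
Unset Printing Implicit Defensive.

Global Open Scope classical_set_scope.
Global Open Scope ring_scope.
Global Open Scope complex_scope.

Section Defs.
Variables (R : realType) (n : nat).
Implicit Types (x : 'cV[R]_n) (z : 'cV[R[i]]_n).

(* The library norm `|x| on matrices is the sup norm. *)
Definition enorm x : R := Num.sqrt (\sum_(i < n) x i 0 ^+ 2).

Definition cenorm z : R :=
  Num.sqrt (\sum_(i < n) (complex.Re (z i 0) ^+ 2 + complex.Im (z i 0) ^+ 2)).

(* The inclusion of R^n into C^n. *)
Definition toCn x : 'cV[R[i]]_n := map_mx (real_complex R) x.

Definition locally_lipschitz (G : 'cV[R]_n -> 'cV[R]_n) : Prop :=
  forall x, exists r L : R, [/\ 0 < r, 0 < L &
    forall u v, enorm (u - x) < r -> enorm (v - x) < r ->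
      enorm (G u - G v) <= L * enorm (u - v)].

(* Each coordinate is (evaluation of) an m-homogeneous polynomial in the n
   coordinates. The predicate is m.-homog of mpoly (total degree mpoly.mdeg), with
   the canonical instance written out because mpoly is not imported; the zero
   polynomial satisfies it. *)
Definition homogeneous_polynomial (m : nat) (H : 'cV[R]_n -> 'cV[R]_n) : Prop :=
  exists p : 'I_n -> mpoly.mpoly n R,
    (forall i, p i \is
       mpoly.ishomog1 m (mpoly.mpoly_mdeg__canonical__mpoly_Measure n)) /\
    (forall x i, H x i 0 = mpoly.meval (fun j => x j 0) (p i)).

(* dfwith v l u is the m-tuple v with its l-th entry replaced by u. *)
Definition multilinear (m : nat)
    (L : ('I_m -> 'cV[R]_n) -> 'cV[R]_n) : Prop :=
  forall (v : 'I_m -> 'cV[R]_n) (l : 'I_m) (a : R) (u w : 'cV[R]_n),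
    L (dfwith v l (a *: u + w)) =
    a *: L (dfwith v l u) + L (dfwith v l w).

Definition polynomial_expansion (G : 'cV[R]_n -> 'cV[R]_n)
    (Gm : nat -> 'cV[R]_n -> 'cV[R]_n) : Prop :=
  forall N : nat, (2 <= N)%N -> exists2 delta : R, 0 < delta &
    exists r C : R, [/\ 0 < r, 0 < C & forall x, enorm x < r ->
      enorm (G x - \sum_(2 <= m < N.+1) Gm m x)
        <= C * enorm x `^ (N%:R + delta)].

Definition cexp (w : R[i]) : R[i] :=
  (expR (complex.Re w) * cos (complex.Im w)) +i*
  (expR (complex.Re w) * sin (complex.Im w)).

(* The class F_E(mu, C^n); the vector polynomial p_lambda is stored as its
   column of coordinate polynomials. *)
Definition FE (mu : R) (g : R -> 'cV[R[i]]_n) : Prop :=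
  exists (S : seq R[i]) (p : R[i] -> 'cV[{poly R[i]}]_n),
    [/\ uniq S, forall lambda, lambda \in S -> complex.Re lambda = mu &
      forall t : R, g t = \sum_(lambda <- S)
        cexp (lambda * t%:C) *: map_mx (fun q => q.[t%:C]) (p lambda)].

(* The class F_E(mu, C^n, R^n); its elements, being R^n-valued, are
   represented as functions into R^n. *)
Definition FE_real (mu : R) (g : R -> 'cV[R]_n) : Prop :=
  FE mu (toCn \o g).

Definition bigO_infty (u : R -> 'cV[R[i]]_n) (h : R -> R) : Prop :=
  exists T C : R, [/\ 0 < T, 0 < C &
    forall t, T <= t -> cenorm (u t) <= C * h t].

(* Sequences are indexed from 0: gamma k and gk k stand for gamma_(k+1) and
   g_(k+1), so the sum below has the N+1 terms g_1, ..., g_(N+1). *)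
Definition exp_expansion (gamma : nat -> R) (g : R -> 'cV[R[i]]_n)
    (gk : nat -> R -> 'cV[R[i]]_n) : Prop :=
  (forall k, FE (- gamma k) (gk k)) /\
  (forall N : nat, exists2 mu : R, gamma N < mu &
    bigO_infty (fun t => g t - \sum_(k < N.+1) gk k t)
               (fun t => expR (- mu * t))).

(* The double sum over m >= 2 and j_1, ..., j_m with
   mu_(j_1) + ... + mu_(j_m) = mu_k. Sums over classical sets are finitely
   supported sums, defined to be 0 on infinite support; here, mu being
   increasing, divergent and positive, both supports are finite. *)
Definition resonant_sum (calG : forall m, ('I_m -> 'cV[R]_n) -> 'cV[R]_n)
    (mu : nat -> R) (yk : nat -> R -> 'cV[R]_n) (k : nat) (t : R) : 'cV[R]_n :=
  \sum_(m \in [set m : nat | (2 <= m)%N])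
    \sum_(j \in [set j : {ffun 'I_m -> nat} | \sum_(l < m) mu (j l) = mu k])
      calG m (fun l => yk (j l) t).

End Defs.

(* Main.v *)
Require Import Defs.
From mathcomp Require Import ring lra.

Set Implicit Arguments.
Unset Strict Implicit.
Unset Printing Implicit Defensive.

(** A scalar equation [z' + l z = q + h] with [q] an exponential polynomial of
    rate [m] and [h = O(e^{-nu t})], [nu > m], is solved up to [O(e^{-nu' t})],
    [nu' > m], by an exponential polynomial of rate [m]: subtract a particular
    solution and read the behaviour of [e^{lt} z] off its derivative, by the mean
    value theorem. Trigonalising [A] over the complex numbers extends this to
    systems, row by row; taking real parts returns to R^n.

    A Lyapunov function for [A], almost diagonalised, shows that [y] decays at
    every rate below [mu_1]. If [y_1, ..., y_N] are known and the remainder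
    [w = y - y_1 - ... - y_N] is [O(e^{-rho t})] with [rho > mu_N], multilinearity
    gives [G(y)] up to a rate greater than [mu_(N+1)]: the terms containing [w]
    have rate [rho + mu_1 - epsilon], and [mu_N + mu_1 >= mu_(N+1)] because S is
    closed under addition. So [w] solves a linear system of the above kind, with
    [m = mu_(N+1)], and no eigenvalue has real part strictly between [mu_N] and
    [mu_(N+1)]. *)

(** * Exponential decay *)

(** All rates are kept as strict inequalities. A polynomial factor spoils the bound at the exact
    rate of an exponential polynomial, so every estimate gives up a little; this is affordable
    because the exponents are discrete.

    The homogeneous solutions are the obstacle: the term of rate [m] is not determined by its
    equation, and its component along [e^{-lt}] with [Re l = m] has to be read off the given
    solution. Hence the terms are chosen one after another from [y] itself. Since the equation of
    each term involves only earlier terms, a new choice leaves the previous equations intact.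

    The start is of another kind: [y -> 0] gives no exponential rate, so [G(y)] cannot yet be
    treated as a known error in a linear system, and a nonlinear estimate is required.

    The equations of the terms hold on all of R because the terms are explicit formulas; only the
    remainders are confined to large times. *)

Section RealDecay.
Variable R : realType.
Implicit Types (u v : R -> R) (r s : R).

(** No sign is imposed on [T] or [C]; where [0 <= C] is needed, it follows from the bound at any one
    time. *)
Definition decay r u : Prop :=
  exists T C : R, forall t, T <= t -> `|u t| <= C * expR (- r * t).

Lemma decay_eventually r u v T :
  decay r u -> (forall t, T <= t -> u t = v t) -> decay r v.
Proof.
move=> [T1 [C uC]] uv; exists (Num.max T T1), C => t.
by rewrite ge_max => /andP[/uv <- /uC].
Qed.

Lemma decay_ext r u v : decay r u -> (forall t, u t = v t) -> decay r v.
Proof. by move=> du uv; apply: (decay_eventually (T := 0) du) => t _. Qed.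

Lemma decay_weaken r s u : r <= s -> decay s u -> decay r u.
Proof.
move=> rs [T [C uC]]; exists (Num.max T 0), C => t.
rewrite ge_max => /andP[Tt t0]; have utC := uC _ Tt.
have C0 : 0 <= C.
  by rewrite -(pmulr_lge0 _ (expR_gt0 (- s * t))); apply: le_trans utC.
apply: (le_trans utC); apply: ler_wpM2l => //.
by rewrite ler_expR ler_wpM2r // lerN2.
Qed.

Lemma decay0 r : decay r (fun=> 0).
Proof. by exists 0, 0 => t _; rewrite normr0 mul0r. Qed.

Lemma decayD r u v : decay r u -> decay r v -> decay r (fun t => u t + v t).
Proof.
move=> [T1 [C1 u1]] [T2 [C2 v2]]; exists (Num.max T1 T2), (C1 + C2) => t.
rewrite ge_max => /andP[/u1 ut /v2 vt].
by rewrite mulrDl (le_trans (ler_normD _ _)) // lerD.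
Qed.

Lemma decayN r u : decay r u -> decay r (fun t => - u t).
Proof. by move=> [T [C uC]]; exists T, C => t /uC; rewrite normrN. Qed.

Lemma decayB r u v : decay r u -> decay r v -> decay r (fun t => u t - v t).
Proof. by move=> du /decayN; apply: decayD. Qed.

Lemma decayM r s u v :
  decay r u -> decay s v -> decay (r + s) (fun t => u t * v t).
Proof.
move=> [T1 [C1 u1]] [T2 [C2 v2]]; exists (Num.max T1 T2), (C1 * C2) => t.
rewrite ge_max => /andP[/u1 ut /v2 vt].
by rewrite opprD mulrDl expRD normrM mulrACA ler_pM.
Qed.

Lemma decayZ r a u : decay r u -> decay r (fun t => a * u t).
Proof.
move=> [T [C uC]]; exists T, (`|a| * C) => t /uC ut.
by rewrite normrM -mulrA ler_wpM2l.
Qed.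

Lemma decay_sum (I : Type) (l : seq I) (P : pred I) (F : I -> R -> R) r :
  (forall i, P i -> decay r (F i)) ->
  decay r (fun t => \sum_(i <- l | P i) F i t).
Proof.
move=> dF; elim: l => [|i l IH].
  by apply: (decay_ext (decay0 r)) => t; rewrite big_nil.
have [Pi|nPi] := boolP (P i).
  by apply: (decay_ext (decayD (dF _ Pi) IH)) => t; rewrite big_cons Pi.
by apply: (decay_ext IH) => t; rewrite big_cons (negbTE nPi).
Qed.

Lemma decay_expR a : decay (- a) (fun t => expR (a * t)).
Proof.
by exists 0, 1 => t _; rewrite opprK mul1r ger0_norm // expR_ge0.
Qed.

Lemma decay_cst a : decay 0 (fun=> a).
Proof. by exists 0, `|a| => t _; rewrite oppr0 mul0r expR0 mulr1. Qed.

Lemma decay_id e : 0 < e -> decay (- e) id.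
Proof.
move=> e0; exists 0, e^-1 => t t0; rewrite opprK ger0_norm //.
rewrite mulrC ler_pdivlMr // mulrC (le_trans _ (expR_ge1Dx _)) //.
by rewrite lerDr.
Qed.

Lemma decay_le r u v T :
  decay r v -> (forall t, T <= t -> `|u t| <= v t) -> decay r u.
Proof.
move=> [T1 [C vC]] uv; exists (Num.max T T1), C => t.
rewrite ge_max => /andP[/uv uvt /vC vt].
exact: le_trans (le_trans uvt (ler_norm _)) vt.
Qed.

Lemma decay_norm r u : decay r u -> decay r (fun t => `|u t|).
Proof. by move=> [T [C uC]]; exists T, C => t /uC; rewrite normr_id. Qed.

Lemma decay_cst_eq0 e a : 0 < e -> decay e (fun=> a) -> a = 0.
Proof.
move=> e0 [T [C aC]]; apply/eqP; rewrite -normr_le0; apply/ler_addgt0Pl => d d0.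
rewrite addr0.
(* At this time [|C| <= d * (e * t) <= d * expR (e * t)], so the constant is at most [d] in absolute
   value. *)
pose t := Num.max (Num.max T 0) (`|C| / (d * e)).
have [Tt t0] : T <= t /\ 0 <= t by rewrite /t !le_max !lexx !orbT.
have Ct : `|C| <= d * e * t.
  by rewrite mulrC -ler_pdivrMr ?mulr_gt0 // /t le_max lexx orbT.
apply: le_trans (aC t Tt) _.
rewrite mulNr expRN ler_pdivrMr ?expR_gt0 //.
apply: le_trans (ler_norm _) _; apply: le_trans Ct _.
rewrite -mulrA; apply: ler_wpM2l; first exact: ltW.
by apply: le_trans _ (expR_ge1Dx _); rewrite lerDr.
Qed.

Lemma derD (t : R) u v du dv : is_derive t 1 u du -> is_derive t 1 v dv ->
  is_derive t 1 (fun t => u t + v t) (du + dv).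
Proof. exact: is_deriveD. Qed.

Lemma derN (t : R) u du : is_derive t 1 u du ->
  is_derive t 1 (fun t => - u t) (- du).
Proof. exact: is_deriveN. Qed.

Lemma derB (t : R) u v du dv : is_derive t 1 u du -> is_derive t 1 v dv ->
  is_derive t 1 (fun t => u t - v t) (du - dv).
Proof. exact: is_deriveB. Qed.

Lemma derM (t : R) u v du dv : is_derive t 1 u du -> is_derive t 1 v dv ->
  is_derive t 1 (fun t => u t * v t) (du * v t + u t * dv).
Proof.
move=> u' v'; have := is_deriveM u' v'.
by rewrite /GRing.scale /= addrC [v t * _]mulrC.
Qed.

Lemma derZ (t a : R) u du : is_derive t 1 u du ->
  is_derive t 1 (fun t => a * u t) (a * du).
Proof. exact: is_deriveZ. Qed.

Lemma der_sum (I : Type) (l : seq I) (P : pred I) (t : R) (F : I -> R -> R)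
    (dF : I -> R) :
  (forall i, P i -> is_derive t 1 (F i) (dF i)) ->
  is_derive t 1 (fun t => \sum_(i <- l | P i) F i t)
                (\sum_(i <- l | P i) dF i).
Proof.
move=> F'; elim: l => [|i l IH].
  rewrite big_nil; have -> : (fun t => \sum_(i <- [::] | P i) F i t) = cst 0.
    by apply/funext => s; rewrite big_nil.
  exact: is_derive_cst.
rewrite big_cons; case: ifPn => [Pi|nPi].
  have -> : (fun t => \sum_(i <- i :: l | P i) F i t) =
            (fun t => F i t + \sum_(i <- l | P i) F i t).
    by apply/funext => s; rewrite big_cons Pi.
  by apply: derD => //; apply: F'.
have -> // : (fun t => \sum_(i <- i :: l | P i) F i t) =
             (fun t => \sum_(i <- l | P i) F i t).
by apply/funext => s; rewrite big_cons (negbTE nPi).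
Qed.

Lemma is_derive_lin (a t : R) : is_derive t 1 ( *%R a) a.
Proof. by have := derZ a (is_derive_id t 1); rewrite mulr1. Qed.

Lemma is_derive_expR_lin (a t : R) :
  is_derive t 1 (fun t => expR (a * t)) (a * expR (a * t)).
Proof.
by have := is_derive1_comp (is_derive_expR (a * t)) (is_derive_lin a t);
   rewrite mulrC.
Qed.

Lemma nincr_of_derive (T : R) v (dv : R -> R) :
  (forall t, T <= t -> is_derive t 1 v (dv t)) ->
  (forall t, T <= t -> dv t <= 0) ->
  forall s t, T <= s -> s <= t -> v t <= v s.
Proof.
move=> v' dv0; apply: ler0_derive1_nincry.
- by move=> x; rewrite in_itv/= andbT => /ltW/v' [].
- move=> x; rewrite in_itv/= andbT => /ltW Tx.
  by rewrite derive1E; have [_ ->] := v' _ Tx; apply: dv0.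
apply: derivable_within_continuous => x; rewrite in_itv/= andbT.
by move=> /v' [].
Qed.

(** The derivative of [C / k * expR (- k * t)] is [- (C * expR (- k * t))], so adding this function
    to [v] gives a nonincreasing function and subtracting it a nondecreasing one. This replaces
    integration of [dv] and serves both signs of [k]. *)
Lemma monotone_corrections (T C k : R) v (dv : R -> R) : k != 0 ->
  (forall t, T <= t -> is_derive t 1 v (dv t)) ->
  (forall t, T <= t -> `|dv t| <= C * expR (- k * t)) ->
  forall s t, T <= s -> s <= t ->
    (v t + C / k * expR (- k * t) <= v s + C / k * expR (- k * s)) /\
    (v s - C / k * expR (- k * s) <= v t - C / k * expR (- k * t)).
Proof.
move=> k0 v' dvC s t Ts st.
have e' (x : R) : is_derive x 1 (fun t => C / k * expR (- k * t))
                      (- (C * expR (- k * x))).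
  by apply: (is_derive_eq (derZ (C / k) (is_derive_expR_lin (- k) x))); field.
split.
  apply: (nincr_of_derive (T := T) (v := fun t => v t + C / k * expR (- k * t))
     (dv := fun t => dv t + - (C * expR (- k * t)))) => // x Tx.
    exact: (derD (v' _ Tx) (e' x)).
  by rewrite subr_le0 (le_trans (ler_norm _)) ?dvC.
rewrite -lerN2; apply: (nincr_of_derive (T := T)
   (v := fun t => - (v t - C / k * expR (- k * t)))
   (dv := fun t => - (dv t - - (C * expR (- k * t))))) => // x Tx.
  exact: (derN (derB (v' _ Tx) (e' x))).
rewrite opprK oppr_le0 -[dv x]opprK addrC subr_ge0.
by rewrite (le_trans _ (dvC _ Tx)) // -normrN ler_norm.
Qed.

(** The limit is the supremum of the nondecreasing minorant [lo]; at each large time it lies between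
    [lo] and the nonincreasing majorant [up], both at distance [C / k * expR (- k * t)] from [v]. *)
Lemma limit_of_decay_derive (T k : R) v dv : 0 < k ->
  (forall t, T <= t -> is_derive t 1 v (dv t)) ->
  decay k dv -> exists l, decay k (fun t => v t - l).
Proof.
move=> k0 v' [T1 [C dvC]]; pose T2 := Num.max T T1.
have kn0 : k != 0 by rewrite gt_eqF.
have d2 t : T2 <= t -> is_derive t 1 v (dv t).
  by rewrite ge_max => /andP[/v'].
have c2 t : T2 <= t -> `|dv t| <= C * expR (- k * t).
  by rewrite ge_max => /andP[_ /dvC].
have mono := monotone_corrections kn0 d2 c2.
pose lo t := v t - C / k * expR (- k * t).
pose up t := v t + C / k * expR (- k * t).
have C0 : 0 <= C.
  rewrite -(pmulr_lge0 _ (expR_gt0 (- k * T2))).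
  by apply: le_trans (c2 _ (lexx _)).
have loup t : lo t <= up t.
  rewrite /lo /up lerD2l (le_trans (y := 0)) ?oppr_le0 //;
  by rewrite mulr_ge0 ?divr_ge0 ?expR_ge0 // ltW.
have cross s t : T2 <= s -> T2 <= t -> lo s <= up t.
  move=> Ts Tt; have [st|/ltW ts] := leP s t.
    by apply: le_trans (mono s t Ts st).2 (loup t).
  by apply: le_trans (loup s) (mono t s Tt ts).1.
pose S := [set lo t | t in [set t | T2 <= t]].
have supS : has_sup S.
  split; first by exists (lo T2), T2 => //=.
  by exists (up T2) => _ [s Ts <-]; apply: cross => //=.
exists (sup S); exists T2, (C / k) => t Tt.
rewrite ler_norml; apply/andP; split.
  rewrite lerBrDr addrC lerBlDr; apply: ge_sup; first by case: supS.
  by move=> _ [s Ts <-]; apply: cross.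
have : lo t <= sup S by apply: sup_upper_bound => //; exists t.
by rewrite /lo lerBlDr lerBlDl addrC.
Qed.

Lemma decay_of_decay_derive (T k : R) v dv : k < 0 ->
  (forall t, T <= t -> is_derive t 1 v (dv t)) ->
  decay k dv -> decay k v.
Proof.
move=> k0 v' [T1 [C dvC]]; pose T2 := Num.max (Num.max T T1) 0.
have d2 t : T2 <= t -> is_derive t 1 v (dv t).
  by rewrite !ge_max => /andP[/andP[/v']].
have c2 t : T2 <= t -> `|dv t| <= C * expR (- k * t).
  by rewrite !ge_max => /andP[/andP[_ /dvC]].
have kn0 : k != 0 by rewrite lt_eqF.
have mono := monotone_corrections kn0 d2 c2 (lexx T2).
have [c cE0] : exists c, c = C / k * expR (- k * T2) by eexists.
exists T2, (- (C / k) + `|v T2| + `|c|) => t Tt.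
have [up lo] := mono t Tt.
set E := expR (- k * t) in up lo *.
(* Here [k < 0] and [0 <= t] are used, whence the [0] in [T2]: constants of integration are
   dominated by their multiples by [E]. *)
have E1 : 1 <= E.
  rewrite -expR0 ler_expR mulNr oppr_ge0 mulr_le0_ge0 ?(ltW k0) //.
  by move: Tt; rewrite ge_max => /andP[].
have cE : `|c| <= `|c| * E by rewrite ler_peMr.
have vE : `|v T2| <= `|v T2| * E by rewrite ler_peMr.
rewrite !mulrDl ler_norml.
rewrite -cE0 in up lo.
have c1 := ler_norm c; have c2' := ler_norm (- c); rewrite normrN in c2'.
have v1 := ler_norm (v T2); have v2 := ler_norm (- v T2); rewrite normrN in v2.
move: (C / k) (`|c|) (`|v T2|) up lo cE vE c1 c2' v1 v2 => D nc nv *.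
by apply/andP; split; lra.
Qed.

End RealDecay.

(** * Calculus of complex-valued functions *)

Section ComplexCalculus.
Variable R : realType.
Local Notation C := R[i].
Local Notation Re := (@complex.Re R).
Local Notation Im := (@complex.Im R).
Implicit Types (z w : R -> C) (t r : R).

Lemma eqC (x y : C) : Re x = Re y -> Im x = Im y -> x = y.
Proof. by case: x; case: y => a b c d /= -> ->. Qed.

Lemma ReD (x y : C) : Re (x + y) = Re x + Re y.
Proof. by case: x; case: y. Qed.
Lemma ImD (x y : C) : Im (x + y) = Im x + Im y.
Proof. by case: x; case: y. Qed.
Lemma ReN (x : C) : Re (- x) = - Re x.
Proof. by case: x. Qed.
Lemma ImN (x : C) : Im (- x) = - Im x.
Proof. by case: x. Qed.
Lemma ReM (x y : C) : Re (x * y) = Re x * Re y - Im x * Im y.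
Proof. by case: x; case: y. Qed.
Lemma ImM (x y : C) : Im (x * y) = Re x * Im y + Im x * Re y.
Proof. by case: x; case: y. Qed.
Lemma Re_sum (I : Type) (s : seq I) (P : pred I) (F : I -> C) :
  Re (\sum_(i <- s | P i) F i) = \sum_(i <- s | P i) Re (F i).
Proof. by apply: (big_morph Re) => // x y; rewrite ReD. Qed.
Lemma Im_sum (I : Type) (s : seq I) (P : pred I) (F : I -> C) :
  Im (\sum_(i <- s | P i) F i) = \sum_(i <- s | P i) Im (F i).
Proof. by apply: (big_morph Im) => // x y; rewrite ImD. Qed.

Definition cdecay r z := decay r (Re \o z) /\ decay r (Im \o z).

Lemma cdecay_eventually r z w (T : R) :
  cdecay r z -> (forall t, T <= t -> z t = w t) -> cdecay r w.
Proof.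
by move=> [d1 d2] zw; split; [apply: (decay_eventually (T := T) d1)
  |apply: (decay_eventually (T := T) d2)] => t Tt /=; rewrite zw.
Qed.

Lemma cdecay_ext r z w : cdecay r z -> (forall t, z t = w t) -> cdecay r w.
Proof. by move=> dz zw; apply: (cdecay_eventually (T := 0) dz) => t _. Qed.

Lemma cdecay_weaken r s z : r <= s -> cdecay s z -> cdecay r z.
Proof. by move=> rs [d1 d2]; split; apply: decay_weaken rs _. Qed.

Lemma cdecay0 r : cdecay r (fun=> 0).
Proof. by split; apply: decay0. Qed.

Lemma cdecayD r z w : cdecay r z -> cdecay r w -> cdecay r (fun t => z t + w t).
Proof.
move=> [a b] [c d]; split.
  by apply: (decay_ext (decayD a c)) => t /=; rewrite ReD.
by apply: (decay_ext (decayD b d)) => t /=; rewrite ImD.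
Qed.

Lemma cdecayN r z : cdecay r z -> cdecay r (fun t => - z t).
Proof.
move=> [a b]; split.
  by apply: (decay_ext (decayN a)) => t /=; rewrite ReN.
by apply: (decay_ext (decayN b)) => t /=; rewrite ImN.
Qed.

Lemma cdecayB r z w : cdecay r z -> cdecay r w -> cdecay r (fun t => z t - w t).
Proof. by move=> dz /cdecayN; apply: cdecayD. Qed.

Lemma cdecayM r s z w :
  cdecay r z -> cdecay s w -> cdecay (r + s) (fun t => z t * w t).
Proof.
move=> [a b] [c d]; split.
  by apply: (decay_ext (decayB (decayM a c) (decayM b d))) => t /=; rewrite ReM.
by apply: (decay_ext (decayD (decayM a d) (decayM b c))) => t /=; rewrite ImM.
Qed.

Lemma cdecay_cst (a : C) : cdecay 0 (fun=> a).
Proof. by split; apply: decay_cst. Qed.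

Lemma cdecayZ r (a : C) z : cdecay r z -> cdecay r (fun t => a * z t).
Proof. by move=> /(cdecayM (cdecay_cst a)); rewrite add0r. Qed.

Lemma cdecay_sum (I : Type) (l : seq I) (P : pred I) (F : I -> R -> C) r :
  (forall i, P i -> cdecay r (F i)) ->
  cdecay r (fun t => \sum_(i <- l | P i) F i t).
Proof.
move=> dF; split.
  apply: (decay_ext (decay_sum l (P := P) (F := fun i => Re \o F i) (r := r) _)).
    by move=> i /dF[].
  by move=> t /=; rewrite Re_sum.
apply: (decay_ext (decay_sum l (P := P) (F := fun i => Im \o F i) (r := r) _)).
  by move=> i /dF[].
by move=> t /=; rewrite Im_sum.
Qed.

Lemma cdecay_real r (u : R -> R) : decay r u -> cdecay r (fun t => (u t)%:C).
Proof. by move=> du; split => //; apply: decay0. Qed.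

Lemma cexpE (l : C) t : cexp (l * t%:C) =
  (expR (Re l * t) * cos (Im l * t)) +i* (expR (Re l * t) * sin (Im l * t)).
Proof. by rewrite /cexp ReM ImM /= !mulr0 subr0 add0r. Qed.

Lemma cexpD (a b : C) : cexp (a + b) = cexp a * cexp b.
Proof.
by apply: eqC; rewrite ?ReM ?ImM /cexp /= ReD ImD expRD ?cosD ?sinD; ring.
Qed.

Lemma cexp0 : cexp 0 = 1 :> C.
Proof. by rewrite /cexp /= expR0 cos0 sin0 mulr1 mulr0. Qed.

Lemma cexpNK (a : C) : cexp (- a) * cexp a = 1.
Proof. by rewrite -cexpD addNr cexp0. Qed.

Lemma cdecay_cexp (l : C) : cdecay (- Re l) (fun t => cexp (l * t%:C)).
Proof.
split; apply: (decay_le (T := 0) (decay_expR (Re l))) => t _;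
  rewrite /comp cexpE /= normrM ger0_norm ?expR_ge0 // ler_piMr ?expR_ge0 //.
  exact: cos_max.
exact: sin_max.
Qed.

(** Each factor [t] costs an arbitrarily small rate; halving [e] at every step of the Horner
    recursion keeps the total cost equal to [e]. *)
Lemma cdecay_horner (p : {poly C}) (e : R) :
  0 < e -> cdecay (- e) (fun t => p.[t%:C]).
Proof.
elim/poly_ind: p e => [|p c IH] e e0.
  by apply: (cdecay_ext (cdecay0 _)) => t; rewrite horner0.
have e20 : 0 < e / 2 by rewrite divr_gt0.
have d1 := cdecayM (IH _ e20) (cdecay_real (decay_id e20)).
rewrite -opprD -splitr in d1.
have d2 : cdecay (- e) (fun=> c).
  by apply: cdecay_weaken (cdecay_cst c); rewrite oppr_le0 ltW.
by apply: (cdecay_ext (cdecayD d1 d2)) => t; rewrite hornerD hornerMX hornerC.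
Qed.

(** The variable is real; differentiating the two parts separately makes the real mean value theorem
    applicable to each. *)
Definition cder z t (d : C) :=
  is_derive t 1 (Re \o z) (Re d) /\ is_derive t 1 (Im \o z) (Im d).

Lemma cder_ext z w t d : cder z t d -> (forall t, z t = w t) -> cder w t d.
Proof. by move=> dz /funext <-. Qed.

Lemma cder_eq z t d e : cder z t d -> d = e -> cder z t e.
Proof. by move=> dz <-. Qed.

Lemma cderD z w t d e : cder z t d -> cder w t e ->
  cder (fun t => z t + w t) t (d + e).
Proof.
move=> [a b] [c f]; split.
  have -> : Re \o (fun t => z t + w t) = (fun t => Re (z t) + Re (w t)).
    by apply/funext => s /=; rewrite ReD.
  by rewrite ReD; exact: (derD a c).
have -> : Im \o (fun t => z t + w t) = (fun t => Im (z t) + Im (w t)).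
  by apply/funext => s /=; rewrite ImD.
by rewrite ImD; exact: (derD b f).
Qed.

Lemma cderM z w t d e : cder z t d -> cder w t e ->
  cder (fun t => z t * w t) t (d * w t + z t * e).
Proof.
move=> [a b] [c f]; split.
  have -> : Re \o (fun t => z t * w t) =
            (fun t => Re (z t) * Re (w t) - Im (z t) * Im (w t)).
    by apply/funext => s /=; rewrite ReM.
  apply: (is_derive_eq (derB (derM a c) (derM b f))).
  by rewrite ReD !ReM /=; ring.
have -> : Im \o (fun t => z t * w t) =
          (fun t => Re (z t) * Im (w t) + Im (z t) * Re (w t)).
  by apply/funext => s /=; rewrite ImM.
apply: (is_derive_eq (derD (derM a f) (derM b c))).
by rewrite ImD !ImM /=; ring.
Qed.

Lemma cder_cst (a : C) t : cder (fun=> a) t 0.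
Proof. by split; apply: is_derive_cst. Qed.

Lemma cderZ (a : C) z t d : cder z t d -> cder (fun t => a * z t) t (a * d).
Proof.
by move=> dz; apply: (cder_eq (cderM (cder_cst a t) dz)); rewrite mul0r add0r.
Qed.

Lemma cderN z t d : cder z t d -> cder (fun t => - z t) t (- d).
Proof.
move=> dz; apply: (cder_eq (cder_ext (cderZ (-1) dz) _)).
  by move=> s; rewrite mulN1r.
by rewrite mulN1r.
Qed.

Lemma cderB z w t d e : cder z t d -> cder w t e ->
  cder (fun t => z t - w t) t (d - e).
Proof. by move=> dz /cderN; apply: cderD. Qed.

Lemma cder_sum (I : Type) (l : seq I) (P : pred I) t (F : I -> R -> C)
    (dF : I -> C) : (forall i, P i -> cder (F i) t (dF i)) ->
  cder (fun t => \sum_(i <- l | P i) F i t) t (\sum_(i <- l | P i) dF i).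
Proof.
move=> F'; split.
  have -> : Re \o (fun t => \sum_(i <- l | P i) F i t) =
            (fun t => \sum_(i <- l | P i) Re (F i t)).
    by apply/funext => s /=; rewrite Re_sum.
  by rewrite Re_sum; apply: der_sum => i /F'[].
have -> : Im \o (fun t => \sum_(i <- l | P i) F i t) =
          (fun t => \sum_(i <- l | P i) Im (F i t)).
  by apply/funext => s /=; rewrite Im_sum.
by rewrite Im_sum; apply: der_sum => i /F'[].
Qed.

Lemma cder_real (u : R -> R) t (d : R) :
  is_derive t 1 u d -> cder (fun t => (u t)%:C) t d%:C.
Proof. by move=> du; split => //=; apply: is_derive_cst. Qed.

Lemma cder_horner (p : {poly C}) t :
  cder (fun t => p.[t%:C]) t p^`().[t%:C].
Proof.
elim/poly_ind: p => [|p c IH].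
  apply: (cder_eq (cder_ext (cder_cst 0 t) _)) => [s|]; rewrite ?horner0 //.
  by rewrite deriv0 horner0.
have D1 := cderM IH (cder_real (is_derive_id t 1)).
apply: (cder_eq (cder_ext (cderD D1 (cder_cst c t)) _)) => [s|].
  by rewrite hornerD hornerMX hornerC.
by rewrite derivD derivM derivX derivC !addr0 !mulr1 hornerD hornerMX.
Qed.

Lemma cder_cexp (l : C) t :
  cder (fun t => cexp (l * t%:C)) t (l * cexp (l * t%:C)).
Proof.
set a := Re l; set b := Im l.
have ea := is_derive_expR_lin a t.
have cb := is_derive1_comp (is_derive_cos (b * t)) (is_derive_lin b t).
have sb := is_derive1_comp (is_derive_sin (b * t)) (is_derive_lin b t).
split.
  have -> : Re \o (fun t => cexp (l * t%:C)) =
            (fun t => expR (a * t) * cos (b * t)).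
    by apply/funext => s; rewrite /comp cexpE.
  apply: (is_derive_eq (derM ea cb)).
  by rewrite cexpE ReM /= -/a -/b; ring.
have -> : Im \o (fun t => cexp (l * t%:C)) =
          (fun t => expR (a * t) * sin (b * t)).
  by apply/funext => s; rewrite /comp cexpE.
apply: (is_derive_eq (derM ea sb)).
by rewrite cexpE ImM /= -/a -/b; ring.
Qed.

Lemma poly_antideriv (p : {poly C}) : exists q, q^`() = p.
Proof.
exists (\poly_(i < (size p).+1) (p`_i.-1 / i%:R)).
apply/polyP => i; rewrite coef_deriv coef_poly ltnS.
case: ltnP => ip; last by rewrite nth_default // mul0rn.
by rewrite /= -[LHS]mulr_natr divfK // pnatr_eq0.
Qed.

(** For [c != 0] the degree drops: if [q] solves the equation with the derivative of [p] on the
    right, then [c^-1 *: (p - q)] solves it with [p]. The case [c = 0] is the resonant one, where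
    the degree rises. *)
Lemma poly_linear_ode (c : C) (p : {poly C}) : exists q, q^`() + c *: q = p.
Proof.
have [->|c0] := eqVneq c 0.
  by have [q <-] := poly_antideriv p; exists q; rewrite scale0r addr0.
have [k] := ubnP (size p); elim: k p => // k IH p pk.
have [->|p0] := eqVneq p 0; first by exists 0; rewrite deriv0 scaler0 addr0.
have [|q qE] := IH p^`().
  by rewrite (leq_trans (lt_size_deriv p0)).
exists (c^-1 *: (p - q)); rewrite derivZ derivB scalerA divff // scale1r -qE.
rewrite addrAC subrr add0r.
by rewrite scalerA mulVf // scale1r addrC addrNK.
Qed.

End ComplexCalculus.

(** * Exponential polynomials and the scalar equation *)

Arguments cexp : simpl never.

Section ExponentialPolynomials.
Variable R : realType.
Local Notation C := R[i].
Local Notation Re := (@complex.Re R).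
Local Notation Im := (@complex.Im R).
Implicit Types (z w : R -> C) (t r m : R).

(* The scalar version of [FE]; repeated exponents are allowed. *)
Definition SE m z := exists s : seq (C * {poly C}),
  (forall x, x \in s -> Re x.1 = m) /\
  forall t, z t = \sum_(x <- s) x.2.[t%:C] * cexp (x.1 * t%:C).

Lemma SE_ext m z w : SE m z -> (forall t, z t = w t) -> SE m w.
Proof. by move=> [s [sm zE]] zw; exists s; split=> // t; rewrite -zw. Qed.

Lemma SE0 m : SE m (fun=> 0).
Proof. by exists [::]; split=> // t; rewrite big_nil. Qed.

Lemma SE_monomial (l : C) (p : {poly C}) :
  SE (Re l) (fun t => p.[t%:C] * cexp (l * t%:C)).
Proof.
exists [:: (l, p)]; split=> [x|t]; last by rewrite big_seq1.
by rewrite inE => /eqP ->.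
Qed.

Lemma SED m z w : SE m z -> SE m w -> SE m (fun t => z t + w t).
Proof.
move=> [s1 [m1 z1]] [s2 [m2 z2]]; exists (s1 ++ s2); split=> [x|t].
  by rewrite mem_cat => /orP[/m1|/m2].
by rewrite big_cat z1 z2.
Qed.

(** Assertions that pass to sums need only be checked on one term [p(t) e^{lt}]; products,
    conjugates, decay and solvability are all treated in this way. *)
Lemma SE_ind m (P : (R -> C) -> Prop) :
  (forall z w, P z -> (forall t, z t = w t) -> P w) ->
  P (fun=> 0) ->
  (forall z w, P z -> P w -> P (fun t => z t + w t)) ->
  (forall (l : C) p, Re l = m -> P (fun t => p.[t%:C] * cexp (l * t%:C))) ->
  forall z, SE m z -> P z.
Proof.
move=> Pext P0 PD Pm z [s [sm zE]]; apply: (Pext _ _ _ (fun t => esym (zE t))).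
elim: s sm {z zE} => [|x s IH] sm.
  by apply: (Pext _ _ P0) => t; rewrite big_nil.
have {}IH := IH (fun y ys => sm y (mem_behead (s := x :: s) ys)).
have Px := Pm x.1 x.2 (sm x (mem_head _ _)).
by apply: (Pext _ _ (PD _ _ Px IH)) => t; rewrite big_cons.
Qed.

Lemma SE_sum (I : Type) (l : seq I) (P : pred I) (F : I -> R -> C) m :
  (forall i, P i -> SE m (F i)) -> SE m (fun t => \sum_(i <- l | P i) F i t).
Proof.
move=> dF; elim: l => [|i l IH].
  by apply: (SE_ext (SE0 m)) => t; rewrite big_nil.
have [Pi|nPi] := boolP (P i).
  by apply: (SE_ext (SED (dF _ Pi) IH)) => t; rewrite big_cons Pi.
by apply: (SE_ext IH) => t; rewrite big_cons (negbTE nPi).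
Qed.

Lemma SEM m k z w : SE m z -> SE k w -> SE (m + k) (fun t => z t * w t).
Proof.
move=> sz sw; move: z sz; apply: SE_ind.
- by move=> z z' sz zz'; apply: (SE_ext sz) => t; rewrite zz'.
- by apply: (SE_ext (SE0 _)) => t; rewrite mul0r.
- by move=> z z' sz sz'; apply: (SE_ext (SED sz sz')) => t; rewrite mulrDl.
move=> l p lm; move: w sw; apply: SE_ind.
- by move=> z z' sz zz'; apply: (SE_ext sz) => t; rewrite zz'.
- by apply: (SE_ext (SE0 _)) => t; rewrite mulr0.
- by move=> z z' sz sz'; apply: (SE_ext (SED sz sz')) => t; rewrite mulrDr.
move=> l' p' lk; rewrite -lm -lk -ReD.
apply: (SE_ext (SE_monomial (l + l') (p * p'))) => t.
by rewrite mulrDl cexpD hornerM mulrACA.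
Qed.

Lemma SE_cst (a : C) : SE 0 (fun=> a).
Proof.
apply: (SE_ext (SE_monomial 0 a%:P)) => t.
by rewrite hornerC mul0r cexp0 mulr1.
Qed.

Lemma SEZ (a : C) m z : SE m z -> SE m (fun t => a * z t).
Proof. by move=> /(SEM (SE_cst a)); rewrite add0r. Qed.

Lemma SEB m z w : SE m z -> SE m w -> SE m (fun t => z t - w t).
Proof.
move=> sz /(SEZ (-1)) sw; apply: (SE_ext (SED sz sw)) => t.
by rewrite mulN1r.
Qed.

Lemma SE_cexp (l : C) : SE (Re l) (fun t => cexp (l * t%:C)).
Proof.
by apply: (SE_ext (SE_monomial l 1)) => t; rewrite hornerC mul1r.
Qed.

Lemma SE_prod (k : nat) (m : 'I_k -> R) (F : 'I_k -> R -> C) :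
  (forall i, SE (m i) (F i)) ->
  SE (\sum_(i < k) m i) (fun t => \prod_(i < k) F i t).
Proof.
elim: k m F => [|k IH] m F sF.
  by rewrite big_ord0; apply: (SE_ext (SE_cst 1)) => t; rewrite big_ord0.
rewrite big_ord_recl.
apply: (SE_ext (SEM (sF ord0) (IH _ _ (fun i => sF (lift ord0 i))))) => t.
by rewrite big_ord_recl.
Qed.

(** Conjugating an exponent keeps its real part. Real parts therefore stay in the class, which
    allows the return from complex to real systems. *)
Lemma SE_conj m z : SE m z -> SE m (fun t => conjc (z t)).
Proof.
move: z; apply: SE_ind.
- by move=> z z' sz zz'; apply: (SE_ext sz) => t; rewrite zz'.
- by apply: (SE_ext (SE0 _)) => t; rewrite rmorph0.
- by move=> z z' sz sz'; apply: (SE_ext (SED sz sz')) => t; rewrite rmorphD.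
move=> l p <-; have -> : Re l = Re (conjc l) by case: l.
apply: (SE_ext (SE_monomial (conjc l) (map_poly (@conjc R) p))) => t.
rewrite rmorphM /= -{1}(conjc_real t) horner_map /=; congr (_ * _).
rewrite !cexpE /=; case: l => a b /=.
by rewrite mulNr cosN sinN mulrN !mulr0 subr0 add0r.
Qed.

Lemma SE_Re m z : SE m z -> SE m (fun t => (Re (z t))%:C).
Proof.
move=> sz; apply: (SE_ext (SEZ (2%:R^-1) (SED sz (SE_conj sz)))) => t.
by rewrite ReJ_add mulrC.
Qed.

(** The gap [m - r] pays for the polynomial factors, whence the strict inequality. *)
Lemma SE_cdecay m r z : r < m -> SE (- m) z -> cdecay r z.
Proof.
move=> rm; move: z; apply: SE_ind.
- by move=> z z' sz zz'; apply: (cdecay_ext sz) => t; rewrite zz'.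
- exact: cdecay0.
- exact: cdecayD.
move=> l p lm; have e0 : 0 < m - r by rewrite subr_gt0.
by have := cdecayM (cdecay_horner p e0) (cdecay_cexp l);
   rewrite lm opprK opprB subrK.
Qed.

(** On a term [p(t) e^{kt}] the ansatz [q(t) e^{kt}] leaves the polynomial equation
    [q' + (k + l) q = p]. *)
Lemma SE_linear_ode (l : C) m q : SE m q ->
  exists z, SE m z /\ forall t, cder z t (q t - l * z t).
Proof.
move: q; apply: SE_ind.
- move=> q q' [z [sz dz]] qq'; exists z; split=> // t.
  by rewrite -qq'.
- exists (fun=> 0); split=> [|t]; first exact: SE0.
  by rewrite mulr0 subr0; apply: cder_cst.
- move=> q q' [z [sz dz]] [z' [sz' dz']]; exists (fun t => z t + z' t).
  split=> [|t]; first exact: SED.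
  by apply: (cder_eq (cderD (dz t) (dz' t))); ring.
move=> k p km; have [q qE] := poly_linear_ode (k + l) p.
exists (fun t => q.[t%:C] * cexp (k * t%:C)); split=> [|t].
  by rewrite -km; apply: SE_monomial.
apply: (cder_eq (cderM (cder_horner q t) (cder_cexp k t))).
by rewrite -qE hornerD hornerZ; ring.
Qed.

Lemma climit_of_cdecay_derive (T k : R) (v dv : R -> C) : 0 < k ->
  (forall t, T <= t -> cder v t (dv t)) -> cdecay k dv ->
  exists l, cdecay k (fun t => v t - l).
Proof.
move=> k0 v' [d1 d2].
have [a da] := limit_of_decay_derive k0 (fun t Tt => (v' t Tt).1) d1.
have [b db] := limit_of_decay_derive k0 (fun t Tt => (v' t Tt).2) d2.
exists (a +i* b); split.
  by apply: (decay_ext da) => t /=; rewrite ReD ReN.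
by apply: (decay_ext db) => t /=; rewrite ImD ImN.
Qed.

Lemma cdecay_of_cdecay_derive (T k : R) (v dv : R -> C) : k < 0 ->
  (forall t, T <= t -> cder v t (dv t)) -> cdecay k dv -> cdecay k v.
Proof.
move=> k0 v' [d1 d2]; split.
  exact: (decay_of_decay_derive k0 (fun t Tt => (v' t Tt).1) d1).
exact: (decay_of_decay_derive k0 (fun t Tt => (v' t Tt).2) d2).
Qed.

Lemma cdecay_cst_eq0 e (a : C) : 0 < e -> cdecay e (fun=> a) -> a = 0.
Proof.
move=> e0 [d1 d2]; apply: eqC => /=.
  exact: (decay_cst_eq0 e0 d1).
exact: (decay_cst_eq0 e0 d2).
Qed.

(* After subtracting a particular solution in the class, the remainder [w]
   satisfies [(e^{lt} w)' = e^{lt} h]; this product converges when [Re l <= m],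
   and its limit contributes the term [e^{-lt}] when [Re l = m]. *)
Lemma scalar_expansion (l : C) m nu rho (T : R) z q h : m < nu ->
  (Re l < rho \/ m <= Re l) ->
  SE (- m) q -> cdecay nu h -> cdecay rho z ->
  (forall t, T <= t -> cder z t (q t + h t - l * z t)) ->
  exists (y : R -> C) (nu' : R), [/\ m < nu', SE (- m) y,
    forall t, cder y t (q t - l * y t) & cdecay nu' (fun t => z t - y t)].
Proof.
move=> mnu lrho sq dh dz z'.
have [p [sp p']] := SE_linear_ode l sq.
pose w t := z t - p t.
have w' t : T <= t -> cder w t (h t - l * w t).
  by move=> Tt; apply: (cder_eq (cderB (z' t Tt) (p' t))); rewrite /w; ring.
pose v t := cexp (l * t%:C) * w t.
have v' t : T <= t -> cder v t (cexp (l * t%:C) * h t).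
  move=> Tt; apply: (cder_eq (cderM (cder_cexp l t) (w' t Tt))).
  by rewrite /w; ring.
have wv t : w t = cexp (- l * t%:C) * v t.
  by rewrite /v mulrA mulNr cexpNK mul1r.
have dv' := cdecayM (cdecay_cexp l) dh.
have [lm|ml] := leP (Re l) m; last first.
  (* For [m < Re l] the homogeneous solution decays faster than rate [m], so [p] alone suffices.
     Keeping [nu'] below [Re l] makes [nu' - Re l] negative, as the growth estimate demands. *)
  pose nu' := Num.min nu ((m + Re l) / 2).
  have nul : nu' < Re l by rewrite gt_min; apply/orP; right; lra.
  have mnu' : m < nu' by rewrite lt_min mnu /=; lra.
  have k0 : nu' - Re l < 0 by rewrite subr_lt0.
  have dv'' : cdecay (nu' - Re l) (fun t => cexp (l * t%:C) * h t).
    by apply: cdecay_weaken dv'; rewrite addrC lerD2l ge_min lexx.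
  have dv := cdecay_of_cdecay_derive k0 v' dv''.
  exists p, nu'; split=> //.
  have := cdecayM (cdecay_cexp (- l)) dv.
  rewrite ReN opprK addrC subrK => dw.
  by apply: (cdecay_ext dw) => t; rewrite -wv.
have k0 : 0 < - Re l + nu by rewrite addrC subr_gt0 (le_lt_trans lm).
have [a da] := climit_of_cdecay_derive k0 v' dv'.
have dw : cdecay nu (fun t => w t - a * cexp (- l * t%:C)).
  have := cdecayM (cdecay_cexp (- l)) da.
  rewrite ReN opprK addrA subrr add0r => dw.
  by apply: (cdecay_ext dw) => t; rewrite mulrBr -wv mulrC [a * _]mulrC mulrC.
have sa : SE (- m) (fun t => a * cexp (- l * t%:C)).
  have [lEm|lltm] := eqVneq (Re l) m.
    by rewrite -lEm -ReN; apply: SEZ; apply: SE_cexp.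
  have {lltm lm}lm : Re l < m by rewrite lt_neqAle lltm.
  have lr : Re l < rho by case: lrho => //; rewrite leNgt lm.
  suff -> : a = 0 by apply: (SE_ext (SE0 _)) => t; rewrite mul0r.
  (* Since [r] exceeds [Re l], rate [r] for [w] forces [v] to tend to 0. It is at most [rho] for the
     sake of [z] and below [m] for the sake of [p]. *)
  pose r := Num.min rho ((m + Re l) / 2).
  have rl : Re l < r by rewrite lt_min lr /=; lra.
  have rm : r < m by rewrite gt_min; apply/orP; right; lra.
  have dw0 : cdecay r w.
    apply: cdecayB; last exact: SE_cdecay rm sp.
    by apply: cdecay_weaken dz; rewrite ge_min lexx.
  have dv0 := cdecayM (cdecay_cexp l) dw0.
  have e0 : 0 < - Re l + r by rewrite addrC subr_gt0.
  apply: (cdecay_cst_eq0 e0).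
  have {}da : cdecay (- Re l + r) (fun t => v t - a).
    by apply: cdecay_weaken da; rewrite lerD2l ltW // (lt_trans rm).
  by apply: (cdecay_ext (cdecayB dv0 da)) => t; rewrite /v; ring.
exists (fun t => p t + a * cexp (- l * t%:C)), nu; split=> //.
- exact: SED.
- move=> t; apply: (cder_eq (cderD (p' t) (cderZ a (cder_cexp (- l) t)))).
  by ring.
by apply: (cdecay_ext dw) => t; rewrite /w; ring.
Qed.

(** * Vector-valued exponential polynomials and their coordinates *)

Section Vectors.
Variable n : nat.

Lemma FE_coord m (g : R -> 'cV[C]_n) i : FE m g -> SE m (fun t => g t i 0).
Proof.
move=> [S [p [_ Sm gE]]].
exists [seq (l, p l i 0) | l <- S]; split=> [x /mapP[l /Sm lm ->]//|t].
rewrite gE summxE big_map; apply: eq_bigr => l _.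
by rewrite !mxE mulrC.
Qed.

(** [FE] demands one repetition-free list of exponents for all coordinates: the lists of the
    coordinates are merged, and polynomials sharing an exponent are added. *)
Lemma FE_of_coord m (g : R -> 'cV[C]_n) :
  (forall i, SE m (fun t => g t i 0)) -> FE m g.
Proof.
move=> /choice[s sP].
pose S := undup (flatten [seq [seq x.1 | x <- s i] | i <- enum 'I_n]).
exists S, (fun l => \col_i \sum_(x <- s i | x.1 == l) x.2).
split; first exact: undup_uniq.
  move=> l; rewrite mem_undup => /flatten_mapP[i _ /mapP[x xs ->]].
  exact: (sP i).1.
move=> t; apply/colP => i; rewrite (sP i).2 summxE.
transitivity (\sum_(l <- S) \sum_(x <- s i | x.1 == l)
                x.2.[t%:C] * cexp (x.1 * t%:C)); last first.
  apply: eq_bigr => l _; rewrite !mxE horner_sum mulr_sumr.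
  by apply: eq_bigr => x /eqP <-; rewrite mulrC.
rewrite (exchange_big_dep xpredT) //=; apply: eq_big_seq => x xs.
rewrite big_mkcond (bigD1_seq x.1) ?undup_uniq //=; last first.
  rewrite mem_undup; apply/flatten_mapP; exists i; rewrite ?mem_enum //.
  exact: map_f.
rewrite eqxx big1 ?addr0 // => l.
by rewrite eq_sym => /negbTE ->.
Qed.

End Vectors.
End ExponentialPolynomials.

(** * Linear systems *)

Lemma colD (V : zmodType) k (u v : 'cV[V]_k) i : (u + v) i 0 = u i 0 + v i 0.
Proof. by rewrite mxE. Qed.

Lemma colN (V : zmodType) k (u : 'cV[V]_k) i : (- u) i 0 = - u i 0.
Proof. by rewrite mxE. Qed.

Section LinearSystems.
Variable R : realType.
Variable n : nat.
Local Notation C := R[i].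
Local Notation Re := (@complex.Re R).
Local Notation Im := (@complex.Im R).

(** [is_trig_mx] means lower triangular, so a system can be solved from its first row downwards.
    Eigenvectors are rows here: [v] for the triangular matrix becomes [v *m P] for [A]. *)
Lemma trigonalization (A : 'M[C]_n) : exists P T : 'M[C]_n,
  [/\ P \in unitmx, is_trig_mx T, P *m A = T *m P &
      forall i, eigenvalue A (T i i)].
Proof.
have [|P Punitary] := @cotrigonalization _ n [:: A].
  by move=> B D; rewrite !inE => /eqP -> /eqP ->.
rewrite /= andbT => trigA.
have Pu := unitarymx_unit Punitary.
have PA : P *m A = conjmx P A *m P.
  by apply/(similarP Pu); rewrite /similar_to /=.
exists P, (conjmx P A); split=> // i.
have : eigenvalue (conjmx P A) (conjmx P A i i).
  rewrite eigenvalue_root_char (char_poly_trig trigA) rootE horner_prod.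
  by rewrite (bigD1 i) //= hornerXsubC subrr mul0r.
move=> /eigenvalueP[v vA v0]; apply/eigenvalueP; exists (v *m P).
  by rewrite -mulmxA PA mulmxA vA scalemxAl.
by apply: contra v0 => /eqP vP0; rewrite -(mulmxK Pu v) vP0 mul0mx.
Qed.

(** Forward substitution: in row [i] the terms found for the earlier rows join the exponential
    polynomial, and their errors join the decaying part. The rate of the remainder may shrink from
    row to row but stays above [m]. *)
Lemma triangular_expansion (A : 'M[C]_n) (m nu rho T : R)
    (z q h : 'I_n -> R -> C) :
  is_trig_mx A -> m < nu ->
  (forall i, Re (A i i) < rho \/ m <= Re (A i i)) ->
  (forall i, SE (- m) (q i)) ->
  (forall i, cdecay nu (h i)) ->
  (forall i, cdecay rho (z i)) ->
  (forall i t, T <= t ->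
     cder (z i) t (q i t + h i t - \sum_j A i j * z j t)) ->
  exists (y : 'I_n -> R -> C) (nu' : R), [/\ m < nu',
    forall i, SE (- m) (y i),
    forall i t, cder (y i) t (q i t - \sum_j A i j * y j t) &
    forall i, cdecay nu' (fun t => z i t - y i t)].
Proof.
move=> /is_trig_mxP trigA mnu Aii sq dh dz z'.
have rowE (i : 'I_n) (u : 'I_n -> C) : \sum_j A i j * u j =
    \sum_(j < n | (j < i)%N) A i j * u j + A i i * u i.
  rewrite (bigID (fun j : 'I_n => (j < i)%N)) /=; congr (_ + _).
  rewrite (bigD1 i) ?ltnn //= big1 ?addr0 // => j /andP[].
  rewrite -leqNgt leq_eqVlt => /orP[/eqP/val_inj -> /eqP//|ij _].
  by rewrite trigA // mul0r.
suff /(_ n (leqnn n)) [y [nu' [mnu' H]]] : forall k, (k <= n)%N ->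
    exists (y : 'I_n -> R -> C) (nu' : R), m < nu' /\ forall i : 'I_n,
      (i < k)%N -> [/\ SE (- m) (y i),
        forall t, cder (y i) t (q i t - \sum_j A i j * y j t) &
        cdecay nu' (fun t => z i t - y i t)].
  exists y, nu'; split=> //.
  - by move=> i; have [] := H i (ltn_ord i).
  - by move=> i; have [] := H i (ltn_ord i).
  - by move=> i; have [] := H i (ltn_ord i).
elim=> [_|k IH kn]; first by exists (fun _ _ => 0), nu; split.
have [y [nu1 [mnu1 H]]] := IH (ltnW kn).
pose i0 := Ordinal kn.
pose q0 t := q i0 t - \sum_(j < n | (j < k)%N) A i0 j * y j t.
pose h0 t := h i0 t - \sum_(j < n | (j < k)%N) A i0 j * (z j t - y j t).
have sq0 : SE (- m) q0.
  apply: SEB => //; apply: SE_sum => j jk; apply: SEZ.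
  by have [] := H j jk.
have dh0 : cdecay (Num.min nu nu1) h0.
  apply: cdecayB; first by apply: cdecay_weaken (dh i0); rewrite ge_min lexx.
  apply: cdecay_sum => j jk; apply: cdecayZ.
  have [_ _] := H j jk; apply: cdecay_weaken.
  by rewrite ge_min lexx orbT.
have [|t Tt|y0 [nu2 [mnu2 sy0 y0' dy0]]] :=
    scalar_expansion (T := T) _ (Aii i0) sq0 dh0 (dz i0).
- by rewrite lt_min mnu.
- apply: (cder_eq (z' i0 t Tt)); rewrite rowE /q0 /h0.
  have -> : \sum_(j < n | (j < k)%N) A i0 j * (z j t - y j t) =
      \sum_(j < n | (j < k)%N) A i0 j * z j t -
      \sum_(j < n | (j < k)%N) A i0 j * y j t.
    by rewrite -sumrB; apply: eq_bigr => j _; rewrite mulrBr.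
  by rewrite /=; ring.
exists (fun i => if i == i0 then y0 else y i), (Num.min nu1 nu2).
split=> [|i]; first by rewrite lt_min mnu1.
rewrite ltnS leq_eqVlt => /orP[/eqP ik|ik].
  have -> : i = i0 by apply: val_inj.
  rewrite eqxx; split=> // [t|]; last first.
    by apply: cdecay_weaken dy0; rewrite ge_min lexx orbT.
  apply: (cder_eq (y0' t)); rewrite rowE eqxx /q0 /= opprD addrA.
  congr (_ - _ - _); apply: eq_bigr => j jk.
  by rewrite -val_eqE /= (ltn_eqF jk).
have ii0 : (i == i0) = false by rewrite -val_eqE /= (ltn_eqF ik).
rewrite ii0; have [si y' di] := H i ik; split=> // [t|]; last first.
  by apply: cdecay_weaken di; rewrite ge_min lexx.
apply: (cder_eq (y' t)); rewrite !rowE ii0; congr (_ - (_ + _)).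
apply: eq_bigr => j ji; rewrite -val_eqE /= (ltn_eqF (ltn_trans ji ik)) //.
Qed.

Lemma Re_mulmx_real (A : 'M[R]_n) (v : 'cV[C]_n) i :
  Re ((map_mx (real_complex R) A *m v) i 0) =
  (A *m (map_mx Re v)) i 0.
Proof.
rewrite !mxE Re_sum; apply: eq_bigr => j _.
by rewrite !mxE ReM /= mul0r subr0.
Qed.

(** The vector [eta] obtained by undoing the change of basis need not be real. As [A], [g] and [w]
    are real, its real part solves the same equation and approximates [w] equally well. *)
Lemma linear_expansion (A : 'M[R]_n) (m nu rho T : R) (w g h : R -> 'cV[R]_n) :
  m < nu ->
  (forall L : C, eigenvalue (map_mx (real_complex R) A) L ->
     Re L < rho \/ m <= Re L) ->
  (forall i, SE (- m) (fun t => (g t i 0)%:C)) ->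
  (forall i, decay nu (fun t => h t i 0)) ->
  (forall i, decay rho (fun t => w t i 0)) ->
  (forall i t, T <= t ->
     is_derive t 1 (fun t => w t i 0) ((g t + h t - A *m w t) i 0)) ->
  exists (y : R -> 'cV[R]_n) (nu' : R), [/\ m < nu',
    forall i, SE (- m) (fun t => (y t i 0)%:C),
    forall i (t : R), is_derive t 1 (fun t => y t i 0) ((g t - A *m y t) i 0) &
    forall i, decay nu' (fun t => (w t - y t) i 0)].
Proof.
move=> mnu eigA sg dh dw w'.
set AC := map_mx (real_complex R) A in eigA.
have [P [B [Pu trigB PA eigB]]] := trigonalization AC.
pose cplx (u : R -> 'cV[R]_n) (i : 'I_n) (t : R) : C :=
  \sum_j P i j * (u t j 0)%:C.
have cplxE u i t : cplx u i t = (P *m toCn (u t)) i 0.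
  by rewrite mxE; apply: eq_bigr => j _; rewrite mxE.
have [|||||ze [nu' [mnu' sz z' dz]]] :=
  @triangular_expansion B m nu rho T (cplx w) (cplx g) (cplx h) trigB mnu.
- by move=> i; apply: eigA.
- by move=> i; apply: SE_sum => j _; apply: SEZ.
- by move=> i; apply: cdecay_sum => j _; apply: cdecayZ; apply: cdecay_real.
- by move=> i; apply: cdecay_sum => j _; apply: cdecayZ; apply: cdecay_real.
- move=> i t Tt.
  have D := cder_sum (index_enum 'I_n) (P := xpredT)
    (fun j _ => cderZ (P i j) (cder_real (w' j t Tt))).
  apply: (cder_eq D).
  transitivity ((P *m toCn (g t + h t - A *m w t)) i 0).
    by rewrite mxE; apply: eq_bigr => j _; rewrite [in RHS]mxE.
  rewrite /toCn map_mxB map_mxD map_mxM -/AC mulmxBr mulmxDr mulmxA PA -mulmxA.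
  rewrite !colD colN !cplxE; congr (_ - _); rewrite mxE.
  by apply: eq_bigr => j _; rewrite cplxE.
pose zv t : 'cV[C]_n := \col_i ze i t.
pose eta t := invmx P *m zv t.
have eta' i (t : R) : cder (fun t => eta t i 0) t ((toCn (g t) - AC *m eta t) i 0).
  have D := cder_sum (index_enum 'I_n) (P := xpredT)
    (fun j _ => cderZ (invmx P i j) (z' j t)).
  apply: (cder_eq (cder_ext D _)) => [s|].
    by rewrite [in RHS]mxE; apply: eq_bigr => j _; rewrite mxE.
  transitivity ((invmx P *m (P *m toCn (g t) - B *m zv t)) i 0).
    rewrite [in RHS]mxE; apply: eq_bigr => j _; rewrite cplxE; congr (_ * _).
    rewrite colD colN; congr (_ - _).
    by rewrite mxE; apply: eq_bigr => k _; rewrite mxE.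
  have BE : invmx P *m (B *m zv t) = AC *m eta t.
    by rewrite /eta -[AC in RHS](mulKmx Pu) PA !mulmxA mulmxK.
  by rewrite mulmxBr (mulKmx Pu) BE.
exists (fun t => map_mx Re (eta t)), nu'; split=> //.
- move=> i.
  have S : SE (- m) (fun t => eta t i 0).
    apply: (SE_ext (SE_sum (index_enum 'I_n) (P := xpredT)
      (fun j _ => SEZ (invmx P i j) (sz j)))) => t.
    by rewrite [in RHS]mxE; apply: eq_bigr => j _; rewrite mxE.
  by apply: (SE_ext (SE_Re S)) => t; rewrite [in RHS]mxE.
- move=> i t; have [D _] := eta' i t.
  have -> : (fun t => map_mx Re (eta t) i 0) = Re \o (fun t => eta t i 0).
    by apply/funext => s; rewrite mxE.
  apply: (is_derive_eq D).
  by rewrite !colD !colN -Re_mulmx_real ReD ReN mxE.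
move=> i.
have D : cdecay nu' (fun t => (toCn (w t) - eta t) i 0).
  apply: (cdecay_ext (cdecay_sum (index_enum 'I_n) (P := xpredT)
      (fun j _ => cdecayZ (invmx P i j) (dz j)))) => t.
  transitivity ((invmx P *m (P *m toCn (w t) - zv t)) i 0).
    by rewrite [in RHS]mxE; apply: eq_bigr => j _; rewrite cplxE !mxE.
  by rewrite mulmxBr (mulKmx Pu).
by apply: (decay_ext D.1) => t; rewrite /= !mxE ReD ReN.
Qed.

End LinearSystems.

(** * Multilinear maps *)

Lemma decay_prod (R : realType) k (r0 : R) (x : 'I_k -> R -> R) :
  (forall l, decay r0 (x l)) -> decay (k%:R * r0) (fun t => \prod_l x l t).
Proof.
elim: k x => [|k IH] x dx.
  rewrite mul0r; apply: (decay_ext (decay_cst 1)) => t.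
  by rewrite big_ord0.
rewrite -nat1r mulrDl mul1r.
apply: (decay_ext (decayM (dx ord0) (IH _ (fun l => dx (lift ord0 l))))) => t.
by rewrite big_ord_recl.
Qed.

(** The first factor is split off by [x0 X - z0 Z = (x0 - z0) X + z0 (X - Z)]; each summand then
    contains one difference and [k] further factors. *)
Lemma decay_prod_diff (R : realType) k (r0 rho : R) (x z : 'I_k.+1 -> R -> R) :
  (forall l, decay r0 (x l)) -> (forall l, decay r0 (z l)) ->
  (forall l, decay rho (fun t => x l t - z l t)) ->
  decay (rho + k%:R * r0) (fun t => \prod_l x l t - \prod_l z l t).
Proof.
elim: k x z => [|k IH] x z dx dz dxz.
  rewrite mul0r addr0; apply: (decay_ext (dxz ord0)) => t.
  by rewrite !big_ord1.
have D1 := decayM (dxz ord0) (decay_prod (fun l => dx (lift ord0 l))).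
have D2 := decayM (dz ord0) (IH _ _ (fun l => dx (lift ord0 l))
  (fun l => dz (lift ord0 l)) (fun l => dxz (lift ord0 l))).
have E : r0 + (rho + k%:R * r0) = rho + k.+1%:R * r0.
  by rewrite -nat1r mulrDl mul1r addrCA.
rewrite E in D2.
apply: (decay_ext (decayD D1 D2)) => t.
by rewrite !big_ord_recl; ring.
Qed.

Section Multilinear.
Variables (R : realType) (n m : nat) (L : ('I_m -> 'cV[R]_n) -> 'cV[R]_n).
Hypothesis Llin : multilinear L.
Implicit Types (v : 'I_m -> 'cV[R]_n) (l : 'I_m).

Lemma multilinear_update0 v l : L (dfwith v l 0) = 0.
Proof.
have := Llin v l 1 0 0; rewrite scaler0 addr0 scale1r => /eqP.
by rewrite -subr_eq0 opprD addrA subrr add0r oppr_eq0 => /eqP.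
Qed.

Lemma multilinear_updateZ v l a (x : 'cV[R]_n) :
  L (dfwith v l (a *: x)) = a *: L (dfwith v l x).
Proof. by rewrite -[a *: x]addr0 Llin multilinear_update0 addr0. Qed.

Lemma multilinear_update_sum (K : Type) (s : seq K) v l (x : K -> 'cV[R]_n) :
  L (dfwith v l (\sum_(k <- s) x k)) = \sum_(k <- s) L (dfwith v l (x k)).
Proof.
elim: s => [|k s IH]; first by rewrite !big_nil multilinear_update0.
by rewrite !big_cons -[x k]scale1r Llin IH !scale1r.
Qed.

Lemma eq_dfwith v v' l x :
  (forall j, j != l -> v' j = v j) -> v' l = x -> v' = dfwith v l x.
Proof.
move=> vv' v'l; apply/funext => j; have [->|jl] := eqVneq j l.
  by rewrite dfwithin.
by rewrite dfwithout 1?eq_sym // vv'.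
Qed.

Lemma multilinearZ (a : 'I_m -> R) v :
  L (fun l => a l *: v l) = (\prod_l a l) *: L v.
Proof.
pose F k : 'I_m -> 'cV[R]_n := fun l => if (l < k)%N then a l *: v l else v l.
suff H k : (k <= m)%N -> L (F k) = (\prod_(l < m | (l < k)%N) a l) *: L v.
  have := H m (leqnn m).
  have -> : F m = (fun l => a l *: v l) by apply/funext => l; rewrite /F ltn_ord.
  by move=> ->; congr (_ *: _); apply: eq_bigl => l; rewrite ltn_ord.
elim: k => [_|k IH km].
  rewrite big_pred0 ?scale1r; last by move=> l.
  by congr L; apply/funext => l; rewrite /F ltn0.
pose l0 := Ordinal km.
have -> : F k.+1 = dfwith (F k) l0 (a l0 *: v l0).
  apply: eq_dfwith => [j jl|]; last by rewrite /F ltnS leqnn.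
  by rewrite /F ltnS leq_eqVlt -[(j : nat) == k]/(j == l0) (negbTE jl).
rewrite multilinear_updateZ (bigD1 l0) //= -scalerA; congr (_ *: _).
have -> : dfwith (F k) l0 (v l0) = F k.
  by apply/esym/eq_dfwith => //; rewrite /F ltnn.
rewrite IH ?(ltnW km) //; congr (_ *: _); apply: eq_bigl => l.
by rewrite ltnS -val_eqE /= ltn_neqAle andbC.
Qed.

Lemma multilinear_sum (K : finType) (u : K -> 'I_m -> 'cV[R]_n) : (0 < m)%N ->
  L (fun l => \sum_k u k l) =
  \sum_(c : {ffun 'I_m -> K}) L (fun l => u (c l) l).
Proof.
(* The averaging below divides by the cardinality of [K], so the empty case is separate: there both
   sides vanish, as [0 < m]. *)
move=> m0; have [K0|Kn0] := eqVneq #|K| 0%N.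
  rewrite big1; last first.
    by move=> c _; have := fintype0 (c (Ordinal m0)); rewrite K0.
  have -> : (fun l => \sum_k u k l) = (fun l => 0 *: (\sum_k u k l)).
    apply/funext => l; rewrite scale0r big1 // => k.
    by have := fintype0 k; rewrite K0.
  by rewrite multilinearZ prodr_const card_ord expr0n eqn0Ngt m0 scale0r.
have N0 : #|K|%:R != 0 :> R by rewrite pnatr_eq0.
pose N : R := #|K|%:R; pose v l := \sum_k u k l.
(* [F r c] picks the summand [c l] in the slots [l < r] only; averaging over the
   choices in the other slots costs the factor [1 / N] per slot. *)
pose F r (c : {ffun 'I_m -> K}) : 'I_m -> 'cV[R]_n :=
  fun l => if (l < r)%N then u (c l) l else N^-1 *: v l.
suff H r : (r <= m)%N -> L v = \sum_c L (F r c).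
  rewrite (H m (leqnn m)); apply: eq_bigr => c _; congr L; apply/funext => l.
  by rewrite /F ltn_ord.
elim: r => [_|r IH rm].
  have -> : \sum_c L (F 0%N c) = \sum_(c : {ffun 'I_m -> K}) N^-1 ^+ m *: L v.
    apply: eq_bigr => c _.
    have -> : F 0%N c = (fun l => N^-1 *: v l) by [].
    by rewrite (multilinearZ (fun=> N^-1) v) prodr_const card_ord.
  rewrite sumr_const card_ffun card_ord -scaler_nat scalerA natrX -exprMn.
  by rewrite divff // expr1n scale1r.
rewrite IH ?(ltnW rm) //; pose l0 := Ordinal rm.
pose upd (c : {ffun 'I_m -> K}) k := [ffun l => if l == l0 then k else c l].
have -> : \sum_c L (F r c) = N^-1 *: \sum_c \sum_k L (F r.+1 (upd c k)).
  rewrite scaler_sumr; apply: eq_bigr => c _.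
  have -> : F r c = dfwith (F r c) l0 (N^-1 *: v l0).
    by apply: eq_dfwith => //; rewrite /F ltnn.
  rewrite multilinear_updateZ multilinear_update_sum; congr (_ *: _).
  apply: eq_bigr => k _; congr L; apply/esym/eq_dfwith => [j jl|].
    rewrite /F ltnS leq_eqVlt -[(j : nat) == r]/(j == l0) (negbTE jl) /=.
    by rewrite ffunE (negbTE jl).
  by rewrite /F ltnS leqnn ffunE eqxx.
rewrite pair_big /=.
(* [phi] exchanges the new choice [k] with the old value of [c] at [l0]. After this reindexing the
   summand no longer depends on [k], and the sum over [k] yields the factor [N] that cancels
   [N^-1]. *)
pose phi (p : {ffun 'I_m -> K} * K) := (upd p.1 p.2, p.1 l0).
have phiK : involutive phi.
  move=> [c k]; rewrite /phi /= ffunE eqxx; congr (_, _).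
  by apply/ffunP => l; rewrite !ffunE; case: eqP => // ->.
rewrite (reindex_inj (inv_inj phiK)) /=.
have -> : \sum_p L (F r.+1 (upd (upd p.1 p.2) (p.1 l0))) =
          \sum_(p : {ffun 'I_m -> K} * K) L (F r.+1 p.1).
  by apply: eq_bigr => p _; have := phiK p; rewrite /phi; case: p => c k [->].
rewrite -(pair_bigA _ (fun c (k : K) => L (F r.+1 c))) /= scaler_sumr.
apply: eq_bigr => c _; rewrite sumr_const -scaler_nat scalerA mulVf //.
by rewrite scale1r.
Qed.

(** Expansion of every argument in the standard basis, with [a c] the value of [L] on basis vectors.
    Estimates for [L] thereby become estimates for products of scalars. *)
Lemma multilinear_coord : (0 < m)%N ->
  exists a : {ffun 'I_m -> 'I_n} -> 'cV[R]_n, forall v i,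
    L v i 0 = \sum_(c : {ffun 'I_m -> 'I_n}) (\prod_l v l (c l) 0) * a c i 0.
Proof.
move=> m0; exists (fun c => L (fun l => delta_mx (c l) 0)) => v i.
have {1}-> : v = (fun l => \sum_(k < n) v l k 0 *: delta_mx k 0).
  apply/funext => l; rewrite {1}[v l]matrix_sum_delta.
  by apply: eq_bigr => k _; rewrite big_ord1.
rewrite (multilinear_sum (fun k l => v l k 0 *: delta_mx k 0)) // summxE.
apply: eq_bigr => c _.
by rewrite (multilinearZ (fun l => v l (c l) 0)) mxE.
Qed.

Lemma multilinear_SE (mu : 'I_m -> R) (y : 'I_m -> R -> 'cV[R]_n) : (0 < m)%N ->
  (forall l i, SE (- mu l) (fun t => (y l t i 0)%:C)) ->
  forall i, SE (- \sum_l mu l) (fun t => (L (fun l => y l t) i 0)%:C).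
Proof.
move=> m0 sy i; have [a aE] := multilinear_coord m0.
apply: (SE_ext (SE_sum (index_enum {ffun 'I_m -> 'I_n}) (P := xpredT)
  (F := fun c t => (a c i 0)%:C * \prod_l (y l t (c l) 0)%:C)
  (m := - \sum_l mu l) _)) => [c _|t].
  by apply: SEZ; rewrite -sumrN; apply: SE_prod.
rewrite aE rmorph_sum /=; apply: eq_bigr => c _.
by rewrite rmorphM rmorph_prod mulrC.
Qed.

(** Differences of [m]-fold products have rate [rho] plus [m - 1] times [r0]; since [2 <= m] and
    [0 <= r0], this is at least [rho + r0]. *)
Lemma multilinear_diff_decay (r0 rho : R) (y s : R -> 'cV[R]_n) : (2 <= m)%N ->
  0 <= r0 ->
  (forall i, decay r0 (fun t => y t i 0)) ->
  (forall i, decay r0 (fun t => s t i 0)) ->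
  (forall i, decay rho (fun t => (y t - s t) i 0)) ->
  forall i, decay (rho + r0)
    (fun t => (L (fun=> y t) - L (fun=> s t)) i 0).
Proof.
move=> m2 r00 dy ds dys i; have [a aE] := multilinear_coord (ltnW m2).
apply: (decay_ext (decay_sum (index_enum {ffun 'I_m -> 'I_n}) (P := xpredT)
  (F := fun c t => a c i 0 *
     (\prod_l y t (c l : 'I_n) 0 - \prod_l s t (c l) 0)) (r := rho + r0) _)).
  move=> c _; apply: decayZ.
  case: m m2 c {aE a} => // k k1 c.
  apply: (@decay_weaken _ _ (rho + k%:R * r0)).
    by rewrite lerD2l ler_peMl // ler1n.
  have dxz (l : 'I_k.+1) : decay rho (fun t => y t (c l) 0 - s t (c l) 0).
    by apply: (decay_ext (dys (c l))) => t; rewrite colD colN.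
  exact: (decay_prod_diff (fun j => dy (c j)) (fun j => ds (c j)) dxz).
move=> t; rewrite colD colN !aE -sumrB; apply: eq_bigr => c _.
by rewrite mulrC mulrBl.
Qed.

Lemma multilinear_bound : (0 < m)%N -> exists K : R, 0 <= K /\
  forall (x : 'cV[R]_n) (e : R), (forall j, `|x j 0| <= e) ->
    forall i, `|L (fun=> x) i 0| <= K * e ^+ m.
Proof.
move=> m0; have [a aE] := multilinear_coord m0.
exists (\sum_(c : {ffun 'I_m -> 'I_n}) \sum_i `|a c i 0|); split.
  by apply: sumr_ge0 => c _; apply: sumr_ge0.
move=> x e xe i; rewrite aE (le_trans (ler_norm_sum _ _ _)) // mulr_suml.
apply: ler_sum => c _; rewrite normrM mulrC; apply: ler_pM => //.
  by rewrite (bigD1 i) //= lerDl sumr_ge0.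
rewrite normr_prod; have -> : e ^+ m = \prod_(l < m) e.
  by rewrite prodr_const card_ord.
by apply: ler_prod => l _; rewrite normr_ge0 xe.
Qed.

End Multilinear.

(** * Decay of small solutions *)

Section InitialDecay.
Variables (R : realType) (n : nat).
Local Notation C := R[i].
Local Notation Re := (@complex.Re R).
Local Notation Im := (@complex.Im R).

(* Conjugating a triangular matrix by [diag (eta^i)] scales the entry [(i, j)] by
   [eta^(i-j)], so the entries off the diagonal can be made small. *)
Lemma almost_diagonalization (A : 'M[C]_n) (eps : R) : 0 < eps ->
  exists P B : 'M[C]_n, [/\ P \in unitmx, P *m A = B *m P,
    forall i j, i != j -> `|Re (B i j)| <= eps /\ `|Im (B i j)| <= eps &
    forall i, eigenvalue A (B i i)].
Proof.
move=> eps0; have [P [T [Pu /is_trig_mxP trigT PA eigT]]] := trigonalization A.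
pose M : R := \sum_i \sum_j (`|Re (T i j)| + `|Im (T i j)|).
have M0 : 0 <= M.
  by apply: sumr_ge0 => i _; apply: sumr_ge0 => j _; rewrite addr_ge0.
have TM i j : `|Re (T i j)| + `|Im (T i j)| <= M.
  rewrite /M (bigD1 i) //= (bigD1 j) //= -addrA lerDl addr_ge0 //.
    by apply: sumr_ge0 => k _; rewrite addr_ge0.
  by apply: sumr_ge0 => l _; apply: sumr_ge0 => k _; rewrite addr_ge0.
(* [eta <= 1] gives [eta ^+ (i - j) <= eta] below the diagonal, and [eta * M <= eps] bounds the
   scaled entries; [M + 1] keeps the denominator positive. *)
pose eta := Num.min 1 (eps / (M + 1)).
have M1 : 0 < M + 1 by rewrite ltr_wpDl.
have eta0 : 0 < eta by rewrite lt_min ltr01 divr_gt0.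
have eta1 : eta <= 1 by rewrite ge_min lexx.
have etaM : eta * M <= eps.
  apply: (@le_trans _ _ (eps / (M + 1) * M)).
    by apply: ler_wpM2r => //; rewrite ge_min lexx orbT.
  by rewrite mulrAC ler_pdivrMr // ler_wpM2l ?ltW // ltrDl.
pose D : 'M[C]_n := diag_mx (\row_i (eta%:C ^+ i)).
(* The subtraction [i - j] is truncated; for [i < j] this is harmless because [T i j] is zero. *)
pose B : 'M[C]_n := \matrix_(i, j) (eta%:C ^+ (i - j) * T i j).
have etaC0 : eta%:C != 0 by rewrite eq_complex /= eqxx andbT gt_eqF.
exists (D *m P), B; split.
- rewrite unitmx_mul Pu andbT unitmxE det_diag unitfE.
  by apply/prodf_neq0 => i _; rewrite mxE expf_neq0.
- rewrite -mulmxA PA mulmxA [in RHS]mulmxA; congr (_ *m _); apply/matrixP => i j.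
  rewrite mul_diag_mx mul_mx_diag !mxE.
  have [ij|ji] := ltnP i j; first by rewrite trigT // !mulr0 mul0r.
  by rewrite mulrAC -exprD subnK.
- move=> i j ij; have [lij|] := ltnP i j.
    by rewrite mxE trigT // mulr0 /= normr0 ltW.
  rewrite leq_eqVlt => /orP[/eqP/val_inj jEi|ji]; first by rewrite jEi eqxx in ij.
  have pw : 0 <= eta ^+ (i - j) <= eta.
    have e0 := ltW eta0.
    by rewrite exprn_ge0 //= -(subnSK ji) exprS ler_piMr // exprn_ile1.
  have pE x : eta%:C ^+ (i - j) * x =
      (eta ^+ (i - j) * Re x) +i* (eta ^+ (i - j) * Im x) :> C.
    by rewrite -rmorphXn; apply: eqC; rewrite ?ReM ?ImM /= mul0r ?subr0 ?addr0.
  rewrite mxE pE /= !normrM ger0_norm; last by case/andP: pw.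
  case/andP: pw => p0 pe.
  have := TM i j; set a := `|Re _|; set b := `|Im _| => abM.
  have a0 : 0 <= a by apply: normr_ge0.
  have b0 : 0 <= b by apply: normr_ge0.
  split; apply: le_trans etaM; apply: ler_pM => //.
    by apply: le_trans abM; rewrite lerDl.
  by apply: le_trans abM; rewrite lerDr.
by move=> i; rewrite mxE subnn expr0 mul1r.
Qed.

Definition mxbound (M : 'M[C]_n) : R :=
  \sum_i \sum_j (`|Re (M i j)| + `|Im (M i j)|).

Lemma mxbound_ge0 M : 0 <= mxbound M.
Proof.
by apply: sumr_ge0 => i _; apply: sumr_ge0 => j _; rewrite addr_ge0.
Qed.

Lemma mulmx_bound (M : 'M[C]_n) (v : 'cV[C]_n) (e : R) : 0 <= e ->
  (forall j, `|Re (v j 0)| <= e /\ `|Im (v j 0)| <= e) ->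
  forall i, `|Re ((M *m v) i 0)| <= mxbound M * e /\
            `|Im ((M *m v) i 0)| <= mxbound M * e.
Proof.
move=> e0 ve i.
have rowM : \sum_j (`|Re (M i j)| + `|Im (M i j)|) * e <= mxbound M * e.
  rewrite -mulr_suml; apply: ler_wpM2r => //.
  rewrite /mxbound [leRHS](bigD1 i) //= lerDl.
  by apply: sumr_ge0 => l _; apply: sumr_ge0 => j _; rewrite addr_ge0.
split; apply: le_trans rowM; rewrite mxE ?Re_sum ?Im_sum;
  apply: (le_trans (ler_norm_sum _ _ _)); apply: ler_sum => j _;
  have [v1 v2] := ve j.
  rewrite ReM (le_trans (ler_normB _ _)) // !normrM mulrDl.
  by apply: lerD; apply: ler_wpM2l.
rewrite ImM (le_trans (ler_normD _ _)) // !normrM mulrDl.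
by apply: lerD; apply: ler_wpM2l.
Qed.

Lemma decay_sqrt (r : R) (u V : R -> R) (T : R) : decay (2 * r) V ->
  (forall t, T <= t -> u t ^+ 2 <= V t) -> decay r u.
Proof.
move=> [T1 [K VK]] uV; exists (Num.max T T1), (`|K| + 1) => t.
rewrite ge_max => /andP[/uV uVt /VK VKt].
set E := expR (- r * t).
have E0 : 0 < E by apply: expR_gt0.
have E2 : expR (- (2 * r) * t) = E ^+ 2.
  by rewrite expr2 -expRD; congr expR; ring.
rewrite -(@ler_pXn2r _ 2) ?nnegrE ?mulr_ge0 ?addr_ge0 ?(ltW E0) //.
rewrite -normrX ger0_norm ?sqr_ge0 // (le_trans uVt) //.
rewrite (le_trans (ler_norm _)) // (le_trans VKt) // E2 exprMn.
apply: ler_wpM2r; first exact: sqr_ge0.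
have := ler_norm K; have := normr_ge0 K; nra.
Qed.

(** The Lyapunov function is [V], the squared norm of [P y], with [P] from the almost
    diagonalisation. It satisfies [V' <= - 2 rho V + Phi / d], where [Phi] comes from the forcing; a
    Gronwall argument gives [V] the rate [2 rho]. *)
Lemma initial_decay (A : 'M[R]_n) (m rho r T K : R) (y Gy F : R -> 'cV[R]_n) :
  (forall L : C, eigenvalue (map_mx (real_complex R) A) L -> m <= Re L) ->
  rho < m -> rho < r ->
  (forall i, decay r (fun t => F t i 0)) ->
  (forall t i, T <= t -> `|Gy t i 0| <= K * \sum_j (y t j 0) ^+ 2) ->
  (forall e : R, 0 < e -> exists T', forall t i, T' <= t -> `|y t i 0| <= e) ->
  (forall i t, T <= t ->
     is_derive t 1 (fun t => y t i 0) ((- (A *m y t) + Gy t + F t) i 0)) ->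
  forall i, decay rho (fun t => y t i 0).
Proof.
move=> eigA rhom rhor dF GK ylim y'.
pose N1 : R := n.+1%:R; have N10 : 0 < N1 by rewrite ltr0n.
pose d := m - rho; have d0 : 0 < d by rewrite subr_gt0.
set AC := map_mx (real_complex R) A in eigA.
have eps0 : 0 < d / (8 * N1) by rewrite divr_gt0 // mulr_gt0.
have [P [B [Pu PA Bsmall eigB]]] := almost_diagonalization AC eps0.
set eps := d / (8 * N1) in eps0 Bsmall.
pose cplx (u : R -> 'cV[R]_n) (i : 'I_n) (t : R) : C := (P *m toCn (u t)) i 0.
pose z := cplx y; pose g := cplx Gy; pose f := cplx F.
pose a i t := Re (z i t); pose b i t := Im (z i t).
pose Nz i t := a i t ^+ 2 + b i t ^+ 2.
pose V t := \sum_i Nz i t.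
pose K3 := mxbound P * (`|K| * (N1 * (mxbound (invmx P)) ^+ 2)).
have Nz0 i t : 0 <= Nz i t by rewrite addr_ge0 ?sqr_ge0.
have V0 t : 0 <= V t by apply: sumr_ge0.
have NV i t : Nz i t <= V t.
  by rewrite /V (bigD1 i) //= lerDl sumr_ge0.
have z' i t : T <= t -> cder (z i) t (- \sum_j B i j * z j t + g i t + f i t).
  move=> Tt.
  have D := cder_sum (index_enum 'I_n) (P := xpredT)
    (fun j _ => cderZ (P i j) (cder_real (y' j t Tt))).
  apply: (cder_eq (cder_ext D _)) => [s|].
    by rewrite /z /cplx mxE; apply: eq_bigr => j _; rewrite mxE.
  transitivity ((P *m toCn (- (A *m y t) + Gy t + F t)) i 0).
    by rewrite [in RHS]mxE; apply: eq_bigr => j _; rewrite [in RHS]mxE.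
  have -> : P *m toCn (- (A *m y t) + Gy t + F t) =
      - (B *m (P *m toCn (y t))) + P *m toCn (Gy t) + P *m toCn (F t).
    rewrite /toCn !map_mxD map_mxN map_mxM -/AC !mulmxDr mulmxN.
    by rewrite [P *m (AC *m _)]mulmxA PA -mulmxA.
  rewrite !colD colN; congr (- _ + _ + _).
  by rewrite mxE; apply: eq_bigr => j _.
have ab i t : `|a i t| <= Num.sqrt (V t) /\ `|b i t| <= Num.sqrt (V t).
  by split; rewrite -sqrtr_sqr ler_sqrt //; apply: le_trans (NV i t);
     rewrite ?lerDl ?lerDr sqr_ge0.
have ybound t j : y t j 0 ^+ 2 <= mxbound (invmx P) ^+ 2 * V t.
  have [|H _] := mulmx_bound (invmx P) (v := P *m toCn (y t))
      (sqrtr_ge0 (V t)) _ j.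
    by move=> i; apply: ab.
  rewrite (mulKmx Pu) mxE /= in H.
  rewrite -[V t]sqr_sqrtr // -exprMn -[y t j 0 ^+ 2]ger0_norm ?sqr_ge0 //.
  rewrite normrX ler_pXn2r // nnegrE //.
  by rewrite mulr_ge0 ?mxbound_ge0 ?sqrtr_ge0.
have gbound i t : T <= t -> `|Re (g i t)| <= K3 * V t /\ `|Im (g i t)| <= K3 * V t.
  move=> Tt.
  have KV : `|K| * \sum_j y t j 0 ^+ 2 <=
      `|K| * (N1 * mxbound (invmx P) ^+ 2) * V t.
    rewrite -[leRHS]mulrA -[N1 * _ * _]mulrA ler_wpM2l //.
    apply: (@le_trans _ _ (\sum_(j < n) mxbound (invmx P) ^+ 2 * V t)).
      by apply: ler_sum => j _; apply: ybound.
    rewrite sumr_const card_ord -[leLHS]mulr_natl ler_wpM2r //.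
      by rewrite mulr_ge0 ?sqr_ge0.
    by rewrite ler_nat.
  have e0 : 0 <= `|K| * \sum_j y t j 0 ^+ 2.
    by rewrite mulr_ge0 // sumr_ge0 // => j _; apply: sqr_ge0.
  have [|H1 H2] := mulmx_bound P (v := toCn (Gy t)) e0 _ i.
    move=> j; rewrite mxE /= normr0; split=> //.
    apply: le_trans (GK t j Tt) _; apply: ler_wpM2r; last exact: ler_norm.
    by rewrite sumr_ge0 // => k _; apply: sqr_ge0.
  have H3 : mxbound P * (`|K| * \sum_j y t j 0 ^+ 2) <= K3 * V t.
    by rewrite /K3 -[leRHS]mulrA; apply: ler_wpM2l => //; apply: mxbound_ge0.
  by split; [apply: le_trans H1 H3 | apply: le_trans H2 H3].
have K30 : 0 <= K3.
  by rewrite !mulr_ge0 ?mxbound_ge0 ?sqr_ge0 // ltW.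
pose e1 := d / (8 * N1 * (K3 + 1)).
have K31 : 0 < K3 + 1 by rewrite ltr_wpDl.
have e10 : 0 < e1 by rewrite divr_gt0 // !mulr_gt0.
have [T1 zsmall] : exists T1, forall i t, T1 <= t ->
    `|a i t| <= e1 /\ `|b i t| <= e1.
  have P1 : 0 < mxbound P + 1 by rewrite ltr_wpDl ?mxbound_ge0.
  have [|T1 yT1] := ylim (e1 / (mxbound P + 1)); first by rewrite divr_gt0.
  exists T1 => i t Tt.
  have [||H1 H2] := mulmx_bound P (v := toCn (y t))
    (e := e1 / (mxbound P + 1)) _ _ i.
  - by rewrite ltW // divr_gt0.
  - move=> j; rewrite mxE /= normr0; split; first exact: yT1.
    by rewrite ltW // divr_gt0.
  have H3 : mxbound P * (e1 / (mxbound P + 1)) <= e1.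
    rewrite mulrCA; apply: ler_piMr; first exact: ltW.
    by rewrite ler_pdivrMr // mul1r lerDl ler01.
  by split; [apply: le_trans H1 H3 | apply: le_trans H2 H3].
pose Phi t := \sum_i (Re (f i t) ^+ 2 + Im (f i t) ^+ 2).
have dPhi : decay (2 * r) Phi.
  have df i : cdecay r (f i).
    apply: (cdecay_ext (cdecay_sum (index_enum 'I_n) (P := xpredT)
      (fun j _ => cdecayZ (P i j) (cdecay_real (dF j))))) => t.
    by rewrite /f /cplx [in RHS]mxE; apply: eq_bigr => j _; rewrite mxE.
  apply: decay_sum => i _; have [d1 d2] := df i.
  have -> : 2 * r = r + r by ring.
  apply: decayD.
    by apply: (decay_ext (decayM d1 d1)) => t; rewrite expr2.
  by apply: (decay_ext (decayM d2 d2)) => t; rewrite expr2.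
pose w i t : C := - \sum_j B i j * z j t + g i t + f i t.
pose V' t := \sum_i 2 * (a i t * Re (w i t) + b i t * Im (w i t)).
have dV t : T <= t -> is_derive t 1 V (V' t).
  move=> Tt; apply: der_sum => i _; have [D1 D2] := z' i t Tt.
  have -> : Nz i = (fun t => (Re \o z i) t * (Re \o z i) t
                           + (Im \o z i) t * (Im \o z i) t).
    by apply/funext => s; rewrite /Nz !expr2.
  apply: (is_derive_eq (derD (derM D1 D1) (derM D2 D2))).
  by rewrite /= -/(w i t) -/(a i t) -/(b i t); ring.
(* The diagonal of [B] contributes at most [- 2 m V], and [- 2 rho = - 2 m + 2 d]. The margin
   [2 d V] is shared out: [d] to the forcing, [d / 2] to the off-diagonal entries by the choice of
   [eps], [d / 2] to the nonlinearity by the choice of [e1]. *)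
have V'le t : Num.max T T1 <= t -> V' t <= - (2 * rho) * V t + Phi t / d.
  rewrite ge_max => /andP[Tt T1t].
  (* This is the real part of the conjugate of [z i t] times [B i j * z j t]; on the diagonal it is
     [Re (B i i)] times the squared modulus. *)
  pose q i j := a i t * Re (B i j * z j t) + b i t * Im (B i j * z j t).
  have qE i j : q i j = Re (B i j) * (a i t * a j t + b i t * b j t)
                      + Im (B i j) * (b i t * a j t - a i t * b j t).
    by rewrite /q ReM ImM -/(a j t) -/(b j t); ring.
  have qoff i j : i != j -> - q i j <= eps * (Nz i t + Nz j t).
    move=> /Bsmall[]; rewrite !ler_norml qE /Nz.
    move: (a i t) (b i t) (a j t) (b j t) (Re _) (Im _) (ltW eps0).
    move=> a1 b1 a2 b2 x1 x2 e0 /andP[xl xu] /andP[yl yu].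
    have H (x u v : R) : - eps <= x -> x <= eps ->
        - (x * (u * v)) <= eps * ((u ^+ 2 + v ^+ 2) / 2).
      move=> x_ge x_le.
      (* The sum of [h1] and [h2] reads [0 <= 2 eps (u^2 + v^2) + 4 x u v]. *)
      have h1 : 0 <= (eps + x) * (u + v) ^+ 2.
        by rewrite mulr_ge0 ?sqr_ge0 // -lerBlDl sub0r.
      have h2 : 0 <= (eps - x) * (u - v) ^+ 2.
        by rewrite mulr_ge0 ?sqr_ge0 // subr_ge0.
      by lra.
    have := H x1 a1 a2 xl xu; have := H x1 b1 b2 xl xu.
    have := H x2 b1 a2 yl yu.
    have := H (- x2) a1 b2; rewrite lerN2 lerNl => /(_ yu yl).
    by lra.
  have qdiag i : - q i i <= - (m * Nz i t).
    rewrite lerN2.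
    have -> : q i i = Re (B i i) * Nz i t by rewrite qE /Nz; ring.
    by apply: ler_wpM2r => //; apply: eigA.
  have qsum i : - \sum_j q i j <= - (m * Nz i t) + \sum_j eps * (Nz i t + Nz j t).
    rewrite (bigD1 i) //= opprD lerD //.
    rewrite [leRHS](bigD1 i) //= -sumrN ler_wpDl //.
      by apply: mulr_ge0; [exact: ltW|apply: addr_ge0; exact: Nz0].
    by apply: ler_sum => j ji; apply: qoff; rewrite eq_sym.
  have wE i : a i t * Re (w i t) + b i t * Im (w i t) =
      - \sum_j q i j + (a i t * Re (g i t) + b i t * Im (g i t))
      + (a i t * Re (f i t) + b i t * Im (f i t)).
    rewrite /w !ReD !ImD ReN ImN Re_sum Im_sum /q big_split /= -!mulr_sumr.
    by ring.
  (* The term is cubic in [z]: one factor is at most [e1], and the quadratic bound on [g] leaves a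
     small multiple of [V]. *)
  have gle i : a i t * Re (g i t) + b i t * Im (g i t) <= 2 * (e1 * (K3 * V t)).
    have [a1 b1] := zsmall i t T1t; have [g1 g2] := gbound i t Tt.
    rewrite (le_trans (ler_norm _)) // (le_trans (ler_normD _ _)) // !normrM.
    by rewrite mulr_natl mulr2n; apply: lerD; apply: ler_pM.
  have fle i : a i t * Re (f i t) + b i t * Im (f i t) <=
      d / 2 * Nz i t + (Re (f i t) ^+ 2 + Im (f i t) ^+ 2) / (2 * d).
    have H (u v : R) : u * v <= d / 2 * u ^+ 2 + v ^+ 2 / (2 * d).
      have : 0 <= (d * u - v) ^+ 2 / (2 * d).
        by rewrite divr_ge0 ?sqr_ge0 // mulr_ge0 // ltW.
      have -> : (d * u - v) ^+ 2 / (2 * d) =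
          d / 2 * u ^+ 2 + v ^+ 2 / (2 * d) - u * v.
        by field; rewrite gt_eqF.
      by rewrite subr_ge0.
    have := H (a i t) (Re (f i t)); have := H (b i t) (Im (f i t)).
    by rewrite /Nz !mulrDr mulrDl; lra.
  have step i : 2 * (a i t * Re (w i t) + b i t * Im (w i t)) <=
      (d - 2 * m) * Nz i t + 2 * \sum_j eps * (Nz i t + Nz j t)
      + 4 * (e1 * (K3 * V t)) + (Re (f i t) ^+ 2 + Im (f i t) ^+ 2) / d.
    have fd : (Re (f i t) ^+ 2 + Im (f i t) ^+ 2) / (2 * d) * 2 =
        (Re (f i t) ^+ 2 + Im (f i t) ^+ 2) / d.
      by field; rewrite gt_eqF.
    rewrite wE -fd; have := qsum i; have := gle i; have := fle i.
    set S1 := \sum_j q i j; set S2 := \sum_j _; lra.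
  apply: le_trans (ler_sum _ (fun i _ => step i)) _.
  rewrite !big_split /= -!mulr_sumr -mulr_suml -/(V t) -/(Phi t).
  rewrite lerD2r.
  have -> : \sum_(i < n) \sum_j eps * (Nz i t + Nz j t) = eps * (2 * n%:R * V t).
    transitivity (\sum_(i < n) eps * (n%:R * Nz i t + V t)).
      apply: eq_bigr => i _; rewrite -mulr_sumr big_split /= sumr_const card_ord.
      by rewrite -[Nz i t *+ n]mulr_natl.
    rewrite -mulr_sumr big_split /= -mulr_sumr sumr_const card_ord -/(V t).
    by rewrite -[V t *+ n]mulr_natl; ring.
  rewrite sumr_const card_ord -[_ *+ n]mulr_natl.
  have nN : n%:R <= N1 by rewrite ler_nat.
  have epsN : eps * n%:R <= d / 8.
    have -> : d / 8 = eps * N1 by rewrite /eps; field; rewrite gt_eqF.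
    by apply: ler_wpM2l nN; rewrite ltW.
  have e1N : n%:R * (4 * (e1 * K3)) <= d / 2.
    apply: (@le_trans _ _ (N1 * (4 * (e1 * (K3 + 1))))).
      have e1' := ltW e10.
      have h0 : 0 <= 4 * (e1 * K3) by apply: mulr_ge0 => //; apply: mulr_ge0.
      have h1 : 4 * (e1 * K3) <= 4 * (e1 * (K3 + 1)).
        by apply: ler_wpM2l => //; apply: ler_wpM2l => //; rewrite lerDl ler01.
      by apply: ler_pM h0 nN h1; rewrite ler0n.
    by rewrite /e1 le_eqVlt; apply/orP; left; apply/eqP; field; rewrite !gt_eqF.
  have h1 := ler_wpM2r (V0 t) epsN; have h2 := ler_wpM2r (V0 t) e1N.
  have -> : rho = m - d by rewrite /d; ring.
  move: h1 h2; set X := eps; set Y := n%:R; lra.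
have V2 : decay (2 * rho) V.
  have [T2 [CP PhiC]] := dPhi.
  pose k := 2 * (r - rho); have k0 : 0 < k by rewrite mulr_gt0 // subr_gt0.
  pose T3 := Num.max (Num.max T T1) T2.
  pose D0 := CP / d.
  (* After multiplication by the integrating factor the forcing is at most [D0 * expR (- k * t)];
     the second summand compensates for it, so that [U] is nonincreasing. *)
  pose U t := expR ((2 * rho) * t) * V t + D0 / k * expR (- k * t).
  have dU t : T3 <= t -> is_derive t 1 U
      ((2 * rho * expR (2 * rho * t)) * V t + expR (2 * rho * t) * V' t +
       D0 / k * (- k * expR (- k * t))).
    rewrite !ge_max => /andP[/andP[Tt _] _].
    exact: (derD (derM (is_derive_expR_lin _ t) (dV t Tt))
                 (derZ _ (is_derive_expR_lin _ t))).
  have U0 := nincr_of_derive dU _.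
  have {}U0 : forall s t, T3 <= s -> s <= t -> U t <= U s.
    apply: U0 => t; rewrite ge_max => /andP[Tt T2t].
    have le1 := V'le t Tt; have le2 := PhiC t T2t.
    set E := expR (2 * rho * t).
    have E0 : 0 < E by apply: expR_gt0.
    have EE : expR (- k * t) = E * expR (- (2 * r) * t).
      by rewrite -expRD; congr expR; rewrite /k; ring.
    have -> : D0 / k * (- k * expR (- k * t)) =
        - (E * (CP * expR (- (2 * r) * t) / d)).
      by rewrite EE /D0; field; rewrite !gt_eqF.
    set X := CP * _ in le2 *.
    have PX : Phi t / d <= X / d.
      by rewrite ler_pM2r ?invr_gt0 // (le_trans (ler_norm _)).
    have -> : 2 * rho * E * V t + E * V' t - E * (X / d) =
        E * (2 * rho * V t + V' t - X / d) by ring.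
    by rewrite pmulr_rle0 //; lra.
  have CP0 : 0 <= CP.
    rewrite -(pmulr_lge0 _ (expR_gt0 (- (2 * r) * T2))).
    by apply: le_trans (PhiC _ (lexx _)).
  exists T3, (U T3) => t Tt.
  rewrite ger0_norm // mulNr expRN ler_pdivlMr ?expR_gt0 // mulrC.
  apply: le_trans (U0 T3 t (lexx _) Tt); rewrite lerDl.
  by rewrite mulr_ge0 ?expR_ge0 // !divr_ge0 // ltW.
have dz i : cdecay rho (z i).
  split; apply: (decay_sqrt (T := 0) V2) => t _; apply: le_trans (NV i t).
    by rewrite lerDl sqr_ge0.
  by rewrite lerDr sqr_ge0.
move=> i.
have D : cdecay rho (fun t => (y t i 0)%:C).
  apply: (cdecay_ext (cdecay_sum (index_enum 'I_n) (P := xpredT)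
      (fun j _ => cdecayZ (invmx P i j) (dz j)))) => t.
  transitivity ((invmx P *m (P *m toCn (y t))) i 0).
    by rewrite [in RHS]mxE; apply: eq_bigr => j _.
  by rewrite (mulKmx Pu) mxE.
exact: D.1.
Qed.

End InitialDecay.

(** * Resonant sums *)

Section EuclideanNorm.
Variables (R : realType) (n : nat).
Implicit Types x : 'cV[R]_n.

Lemma enorm_ge0 x : 0 <= enorm x.
Proof. exact: sqrtr_ge0. Qed.

Lemma enorm_sqr x : enorm x ^+ 2 = \sum_i x i 0 ^+ 2.
Proof. by rewrite sqr_sqrtr // sumr_ge0 // => i _; apply: sqr_ge0. Qed.

Lemma coord_le_enorm x i : `|x i 0| <= enorm x.
Proof.
rewrite -sqrtr_sqr ler_sqrt; last by apply: sumr_ge0 => j _; apply: sqr_ge0.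
by rewrite (bigD1 i) //= lerDl sumr_ge0 // => j _; apply: sqr_ge0.
Qed.

Lemma sqrt_sumsq_le (I : finType) (u : I -> R) :
  Num.sqrt (\sum_i u i ^+ 2) <= \sum_i `|u i|.
Proof.
have S0 : 0 <= \sum_i `|u i| by apply: sumr_ge0.
rewrite -[leRHS]ger0_norm // -sqrtr_sqr ler_sqrt ?sqr_ge0 //.
rewrite expr2 mulr_suml; apply: ler_sum => i _.
rewrite -[u i ^+ 2]ger0_norm ?sqr_ge0 // normrX expr2 ler_wpM2l //.
by rewrite (bigD1 i) //= lerDl sumr_ge0.
Qed.

Lemma enorm_le_sum x : enorm x <= \sum_i `|x i 0|.
Proof. exact: sqrt_sumsq_le. Qed.

Lemma decay_enorm r (y : R -> 'cV[R]_n) :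
  (forall i, decay r (fun t => y t i 0)) -> decay r (fun t => enorm (y t)).
Proof.
move=> dy.
apply: (decay_le (T := 0) (decay_sum (index_enum 'I_n) (P := xpredT)
  (fun i _ => decay_norm (dy i)))) => t _.
by rewrite ger0_norm ?enorm_ge0 ?enorm_le_sum.
Qed.

Lemma polynomial_expansion_coord (G : 'cV[R]_n -> 'cV[R]_n) Gm M :
  polynomial_expansion G Gm -> (2 <= M)%N ->
  exists r K : R, [/\ 0 < r, 0 < K & forall x i, enorm x < r ->
    `|(G x - \sum_(2 <= m < M.+1) Gm m x) i 0| <= K * enorm x ^+ M].
Proof.
move=> GG M2; have [d d0 [r [K [r0 K0 GK]]]] := GG M M2.
(* For norm at most 1 the exponent [M + d] may be lowered to [M]. The vector of norm 0 is treated
   apart, since the comparison of powers needs a positive base. *)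
exists (Num.min r 1), K; split=> // [|x i]; first by rewrite lt_min r0 ltr01.
rewrite lt_min => /andP[xr x1].
apply: le_trans (coord_le_enorm _ i) _; apply: le_trans (GK _ xr) _.
apply: ler_wpM2l; first exact: ltW.
have [->|xn0] := eqVneq (enorm x) 0.
  by rewrite powR0 ?exprn_ge0 // gt_eqF // ltr_wpDl.
have x0 : 0 < enorm x by rewrite lt_neqAle eq_sym xn0 enorm_ge0.
rewrite -powR_mulrn ?enorm_ge0 //; apply: ger_powR; rewrite ?x0 ?(ltW x1) //.
by rewrite lerDl ltW.
Qed.

End EuclideanNorm.

(** * Index bounds and finite form of the resonant sums *)

Section ResonantSums.
Variables (R : realType) (n : nat) (mu : nat -> R).
Variable calG : forall m, ('I_m -> 'cV[R]_n) -> 'cV[R]_n.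
Hypothesis mu_gt0 : forall k, 0 < mu k.
Hypothesis mu_incr : increasing_seq mu.
Implicit Types eta : nat -> R -> 'cV[R]_n.

Lemma mu_lt i j : (mu i < mu j) = (i < j)%N.
Proof. by rewrite !ltNge ltnNge (mu_incr j i). Qed.

Lemma mu_inj i j : mu i = mu j -> i = j.
Proof.
by move=> E; apply/eqP; rewrite eqn_leq -!mu_incr E lexx.
Qed.

(** With at least two positive summands, each is strictly smaller than the total. This makes the
    recursion for the terms well founded. *)
Lemma resonant_index_lt m (j : 'I_m -> nat) k : (2 <= m)%N ->
  \sum_l mu (j l) = mu k -> forall l, (j l < k)%N.
Proof.
move=> m2 E l; rewrite -mu_lt -E (bigD1 l) //= ltrDl.
have [l' l'l] : exists l' : 'I_m, l' != l.
  have m0 : (0 < m)%N by apply: ltnW.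
  have [/eqP l0|l0] := eqVneq (l : nat) 0%N.
    by exists (Ordinal m2); rewrite -val_eqE /= (eqP l0).
  by exists (Ordinal m0); rewrite -val_eqE /= eq_sym.
rewrite (bigD1 l') //= ltr_pwDl // sumr_ge0 // => i _.
exact: ltW.
Qed.

(** Every summand is at least [mu 0], which bounds the number of summands and makes the outer sum
    finite. *)
Lemma resonant_arity_lt m (j : 'I_m -> nat) k M :
  \sum_l mu (j l) = mu k -> mu k < M%:R * mu 0%N -> (m < M)%N.
Proof.
move=> E kM; rewrite ltnNge; apply/negP => Mm.
have : M%:R * mu 0%N <= mu k; last by rewrite leNgt kM.
apply: (@le_trans _ _ (m%:R * mu 0%N)).
  by rewrite ler_pM2r // ler_nat.
rewrite -E; have -> : m%:R * mu 0%N = \sum_(l < m) mu 0%N.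
  by rewrite sumr_const card_ord mulr_natl.
by apply: ler_sum => l _; rewrite mu_incr.
Qed.

Lemma resonant_sum_ext eta eta' k t :
  (forall j, (j < k)%N -> eta j t = eta' j t) ->
  resonant_sum calG mu eta k t = resonant_sum calG mu eta' k t.
Proof.
move=> ee; apply: eq_fsbigr => m; rewrite inE /= => m2.
apply: eq_fsbigr => j; rewrite inE /= => E; congr calG.
by apply/funext => l; apply: ee; apply: resonant_index_lt E l.
Qed.

(** [N] and [M] may be larger than [k] requires, so the resonant sums for all [k <= N] can be
    written over one common index range. *)
Lemma resonant_sumE eta k t N M : (k <= N)%N -> mu k < M%:R * mu 0%N ->
  resonant_sum calG mu eta k t = \sum_(2 <= m < M)
    \sum_(c : {ffun 'I_m -> 'I_N} | \sum_l mu (c l) == mu k)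
      calG (fun l => eta (c l) t).
Proof.
move=> kN kM.
have inner m : (2 <= m)%N ->
  \sum_(j \in [set j : {ffun 'I_m -> nat} | \sum_(l < m) mu (j l) = mu k])
    calG (fun l => eta (j l) t) =
  \sum_(c : {ffun 'I_m -> 'I_N} | \sum_l mu (c l) == mu k)
      calG (fun l => eta (c l) t).
  move=> m2.
  pose emb (c : {ffun 'I_m -> 'I_N}) : {ffun 'I_m -> nat} := [ffun l => c l : nat].
  have embI : injective emb.
    move=> c c' /ffunP E; apply/ffunP => l; apply: val_inj.
    by have := E l; rewrite !ffunE.
  pose s := map emb [seq c : {ffun 'I_m -> 'I_N} <- index_enum _ |
                       \sum_l mu (c l) == mu k].
  have us : uniq s by rewrite map_inj_uniq // filter_uniq // index_enum_uniq.
  have -> : [set j : {ffun 'I_m -> nat} | \sum_(l < m) mu (j l) = mu k] =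
            [set` s].
    apply/seteqP; split=> j /=.
      move=> E; have jN l : (j l < N)%N.
        by apply: leq_trans kN; apply: resonant_index_lt E l.
      apply/mapP; exists [ffun l => Ordinal (jN l)]; last first.
        by apply/ffunP => l; rewrite !ffunE.
      rewrite mem_filter mem_index_enum andbT -E; apply/eqP.
      by apply: eq_bigr => l _; rewrite ffunE.
    move=> /mapP[c]; rewrite mem_filter => /andP[/eqP <- _] ->.
    by apply: eq_bigr => l _; rewrite ffunE.
  rewrite -fsbig_seq // big_map big_filter; apply: eq_bigr => c _.
  by congr calG; apply/funext => l; rewrite ffunE.
rewrite /resonant_sum (fsbigE (index_iota 2 M)) ?iota_uniq //; first last.
- move=> m /= m2; rewrite mem_index_iota m2 /= -leqNgt => Mm.
  apply: fsbig1 => j /= E.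
  by have := resonant_arity_lt E kM; rewrite ltnNge Mm.
- by move=> m /=; rewrite mem_index_iota => /andP[].
rewrite big_seq_cond [RHS]big_seq_cond; apply: eq_big => m.
  rewrite andbT mem_index_iota; case: (leqP 2 m) => //= m2.
  by rewrite mem_set ?andbT.
by rewrite mem_index_iota => /andP[/andP[m2 _] _]; rewrite inner.
Qed.

Lemma resonant_arity k : exists M, mu k < M%:R * mu 0%N.
Proof.
exists (Num.bound (mu k / mu 0%N)).
rewrite -ltr_pdivrMr //.
by apply: archi_boundP; rewrite divr_ge0 // ltW.
Qed.

Lemma resonant_sum_SE eta k :
  (forall m, (2 <= m)%N -> multilinear (calG (m := m))) ->
  (forall j i, (j < k)%N -> SE (- mu j) (fun t => (eta j t i 0)%:C)) ->
  forall i, SE (- mu k) (fun t => (resonant_sum calG mu eta k t i 0)%:C).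
Proof.
move=> calGlin seta i; have [M kM] := resonant_arity k.
pose X m t := \sum_(c : {ffun 'I_m -> 'I_k} | \sum_l mu (c l) == mu k)
  (calG (fun l => eta (c l) t) i 0)%:C.
have S : SE (- mu k) (fun t => \sum_(m <- index_iota 2 M | (2 <= m)%N) X m t).
  apply: SE_sum => m m2; apply: SE_sum => c /eqP <-.
  apply: multilinear_SE; [exact: calGlin|exact: ltnW|].
  by move=> l j; apply: seta.
apply: (SE_ext S) => t.
rewrite (resonant_sumE eta t (leqnn k) kM) summxE rmorph_sum /=.
rewrite big_seq_cond [RHS]big_seq_cond; apply: eq_big => m.
  by rewrite mem_index_iota; case: (leqP 2 m).
by move=> _; rewrite summxE rmorph_sum.
Qed.

Hypothesis mu_add : forall a b, range mu a -> range mu b -> range mu (a + b).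

Lemma mu_sum m (j : 'I_m -> nat) : (0 < m)%N -> range mu (\sum_l mu (j l)).
Proof.
case: m j => // m j _; elim: m j => [|m IH] j.
  by rewrite big_ord1; exists (j ord0).
by rewrite big_ord_recl; apply: mu_add; [exists (j ord0)|apply: IH].
Qed.

(* Expanding [calG m (s, ..., s)] and removing the tuples with sum in
   [{mu_0, ..., mu_N}] leaves only sums that are at least [mu_(N+1)]. *)
Lemma nonresonant_decay eta N M :
  (forall m, (2 <= m)%N -> multilinear (calG (m := m))) ->
  (forall j i, (j < N)%N -> SE (- mu j) (fun t => (eta j t i 0)%:C)) ->
  mu N < M%:R * mu 0%N ->
  exists nu, mu N < nu /\ forall i, decay nu (fun t =>
    (\sum_(2 <= m < M) calG (fun _ : 'I_m => \sum_(k < N) eta k t)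
     - \sum_(k < N.+1) resonant_sum calG mu eta k t) i 0).
Proof.
(* The surviving terms have exponents at least [mu N.+1], but polynomial factors forbid that very
   rate; any value strictly between [mu N] and [mu N.+1] will do. *)
move=> calGlin seta NM; pose nu := (mu N + mu N.+1) / 2.
have NSN : mu N < mu N.+1 by rewrite mu_lt.
exists nu; split; first by rewrite /nu; lra.
have nuN : nu < mu N.+1 by rewrite /nu; lra.
move=> i.
pose X m t := \sum_(c : {ffun 'I_m -> 'I_N} | mu N < \sum_l mu (c l))
  (calG (fun l => eta (c l) t) i 0).
have D : decay nu (fun t => \sum_(m <- index_iota 2 M | (2 <= m)%N) X m t).
  apply: decay_sum => m m2; apply: decay_sum => c Nc.
  have S : SE (- \sum_l mu (c l)) (fun t => (calG (fun l => eta (c l) t) i 0)%:C).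
    apply: multilinear_SE; [exact: calGlin|exact: ltnW|].
    by move=> l j; apply: seta.
  apply: (SE_cdecay (m := \sum_l mu (c l)) _ S).1.
  apply: lt_le_trans nuN _.
  have [q _ qE] := mu_sum (fun l => c l : nat) (ltnW m2).
  by move: Nc; rewrite -qE mu_lt mu_incr.
apply: (decay_ext D) => t.
rewrite colD colN [in X in _ = X]summxE [X in _ - X]summxE.
have -> : \sum_(k < N.+1) resonant_sum calG mu eta k t i 0 =
    \sum_(2 <= m < M) \sum_(k < N.+1)
    \sum_(c : {ffun 'I_m -> 'I_N} | \sum_l mu (c l) == mu k)
      calG (fun l => eta (c l) t) i 0.
  rewrite exchange_big /=; apply: eq_bigr => k _.
  have kN : (k <= N)%N by rewrite -ltnS.
  have kM : mu k < M%:R * mu 0%N by apply: le_lt_trans NM; rewrite mu_incr.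
  rewrite (resonant_sumE eta t kN kM) summxE.
  by apply: eq_bigr => m _; rewrite summxE.
rewrite -sumrB big_seq_cond [RHS]big_seq_cond.
apply: eq_big => m; first by rewrite mem_index_iota; case: (leqP 2 m).
move=> /andP[_ m2].
rewrite (multilinear_sum (calGlin m m2) (fun (k : 'I_N) _ => eta k t));
  last exact: ltnW.
rewrite summxE /X big_mkcond.
have -> : \sum_(k < N.+1) \sum_(c : {ffun 'I_m -> 'I_N} | \sum_l mu (c l) == mu k)
      calG (fun l => eta (c l) t) i 0 =
    \sum_(c : {ffun 'I_m -> 'I_N}) \sum_(k < N.+1)
      (if \sum_l mu (c l) == mu k then calG (fun l => eta (c l) t) i 0 else 0).
  by rewrite exchange_big /=; apply: eq_bigr => k _; rewrite big_mkcond.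
rewrite -sumrB; apply: eq_bigr => c _.
(* The exponent of the tuple is some [mu q]. If [N < q], no resonant sum contains it; otherwise
   exactly the one for [k = q] does, and it cancels. *)
have [q _ qE] := mu_sum (fun l => c l : nat) (ltnW m2).
rewrite -qE mu_lt; have [Nq|qN] := ltnP N q.
  rewrite big1 ?subr0 // => k _; case: eqP => // /mu_inj E.
  by have := ltn_ord k; rewrite -E ltnS leqNgt Nq.
rewrite (bigD1 (Ordinal (qN : q < N.+1)%N)) //= eqxx big1 ?addr0 ?subrr //.
move=> k; rewrite -val_eqE /= => kq; case: eqP => // /mu_inj E.
by rewrite E eqxx in kq.
Qed.

End ResonantSums.

(** * The expansion *)

(** Dependent choice for predicates that see only the first [N] values. The approximations [E N]
    stabilise at each index, and their diagonal is the required sequence. *)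
Lemma exists_sequence_of_extensions (X : Type) (x0 : X)
    (P : nat -> (nat -> X) -> Prop) :
  (forall N e e', (forall k, (k < N)%N -> e k = e' k) -> P N e -> P N e') ->
  P 0%N (fun=> x0) ->
  (forall N e, P N e -> exists x, P N.+1 (fun k => if k == N then x else e k)) ->
  exists e, forall N, P N e.
Proof.
move=> Pext P0 Pstep.
(* Moving [P N e] under the existential makes [next] total, so [E] is a plain recursion that carries
   no proofs. *)
have next_ex N e : exists x, P N e -> P N.+1 (fun k => if k == N then x else e k).
  have [/Pstep[x Px]|nP] := pselect (P N e); first by exists x.
  by exists x0.
pose next N e := sval (cid (next_ex N e)).
pose fix E N : nat -> X := if N is N'.+1 then
  fun k => if k == N' then next N' (E N') else E N' k else fun=> x0.
have PE N : P N (E N).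
  elim: N => // N IH; exact: (svalP (cid (next_ex N (E N))) IH).
have stable k N : (k < N)%N -> E N k = E k.+1 k.
  elim: N => // N IH; rewrite ltnS leq_eqVlt => /orP[/eqP -> //|kN].
  by rewrite [LHS]/= (ltn_eqF kN) IH.
exists (fun k => E k.+1 k) => N; apply: Pext (PE N) => k kN.
exact: stable.
Qed.

(** * Passage between vector statements and coordinates *)

Section Vectors.
Variables (R : realType) (n : nat).

Lemma is_derive_coord (y : R -> 'cV[R]_n) (t : R) i : derivable y t 1 ->
  is_derive t 1 (fun t => y t i 0) (derive1 y t i 0).
Proof.
move=> dy; split; first exact: (derivable_mxP y t 1).1.
by rewrite derive1E derive_mx // mxE.
Qed.

Lemma derive1_of_coord (y : R -> 'cV[R]_n) (t : R) (d : 'cV[R]_n) :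
  (forall i, is_derive t 1 (fun t => y t i 0) (d i 0)) ->
  derivable y t 1 /\ derive1 y t = d.
Proof.
move=> dy; have Dy : derivable y t 1.
  by apply/derivable_mxP => i j; rewrite (ord1 j); have [] := dy i.
split=> //; rewrite derive1E derive_mx //; apply/colP => i; rewrite mxE.
by have [_ ->] := dy i.
Qed.

Lemma cvg0_coord (y : R -> 'cV[R]_n) :
  y t @[t --> +oo] --> (0 : 'cV[R]_n) ->
  forall e : R, 0 < e -> exists T, forall t i, T <= t -> `|y t i 0| <= e.
Proof.
move=> /cvgrPdist_lt y0 e e0; have [T [_ yT]] := y0 e e0.
exists (T + 1) => t i Tt.
have /yT : T < t by rewrite (lt_le_trans _ Tt) // ltrDl.
rewrite sub0r normrN => /ltW; apply: le_trans.
rewrite [leRHS]/Num.Def.normr /= mx_normrE.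
by apply: le_trans (le_bigmax _ _ (i, 0)).
Qed.

Lemma cenorm_toCn (x : 'cV[R]_n) : cenorm (toCn x) = enorm x.
Proof.
rewrite /cenorm /enorm; congr Num.sqrt; apply: eq_bigr => i _.
by rewrite mxE /= expr0n addr0.
Qed.

Lemma toCn_subsum (x : 'cV[R]_n) N (v : 'I_N -> 'cV[R]_n) :
  toCn x - \sum_(k < N) toCn (v k) = toCn (x - \sum_(k < N) v k).
Proof.
rewrite /toCn map_mxB; congr (_ - _); apply/colP => i.
rewrite summxE mxE; under eq_bigr do rewrite mxE.
by rewrite -(raddf_sum (real_complex R)) summxE.
Qed.

Lemma bigO_toCnP (u : R -> 'cV[R]_n) (r : R) :
  bigO_infty (fun t => toCn (u t)) (fun t => expR (- r * t)) <->
  forall i, decay r (fun t => u t i 0).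
Proof.
split=> [[T [K [_ _ uK]]] i|du].
  exists T, K => t Tt; apply: le_trans (uK t Tt).
  by rewrite cenorm_toCn coord_le_enorm.
have [T [K uK]] := decay_enorm du.
exists (Num.max T 1), (`|K| + 1); split=> [||t].
- by rewrite lt_max ltr01 orbT.
- by rewrite ltr_wpDl.
rewrite ge_max => /andP[Tt _]; rewrite cenorm_toCn (le_trans (ler_norm _)) //.
apply: le_trans (uK t Tt) _; apply: ler_wpM2r; first exact: expR_ge0.
by rewrite (le_trans (ler_norm _)) // lerDl.
Qed.

Lemma FE_realP (m : R) (g : R -> 'cV[R]_n) :
  FE_real m g <-> forall i, SE m (fun t => (g t i 0)%:C).
Proof.
split=> [sg i|sg].
  by apply: (SE_ext (FE_coord i sg)) => t; rewrite /= mxE.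
apply: FE_of_coord => i; apply: (SE_ext (sg i)) => t.
by rewrite /= mxE.
Qed.

(** * The nonlinearity along a small solution *)

Variables (G : 'cV[R]_n -> 'cV[R]_n) (Gm : nat -> 'cV[R]_n -> 'cV[R]_n).
Variable calG : forall m, ('I_m -> 'cV[R]_n) -> 'cV[R]_n.
Hypothesis G_exp : polynomial_expansion G Gm.
Hypothesis calG_lin : forall m, (2 <= m)%N -> multilinear (calG (m := m)).
Hypothesis calG_diag :
  forall m, (2 <= m)%N -> forall x, Gm m x = calG (fun _ : 'I_m => x).

Lemma eventually_enorm_lt (y : R -> 'cV[R]_n) (r : R) : 0 < r ->
  (forall e : R, 0 < e -> exists T, forall t i, T <= t -> `|y t i 0| <= e) ->
  exists T, forall t, T <= t -> enorm (y t) < r.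
Proof.
move=> r0 ylim; have N0 : 0 < n.+1%:R :> R by rewrite ltr0n.
have [|T yT] := ylim (r / n.+1%:R); first by rewrite divr_gt0.
exists T => t Tt; apply: le_lt_trans (enorm_le_sum _) _.
apply: (@le_lt_trans _ _ (\sum_(i < n) r / n.+1%:R)).
  by apply: ler_sum => i _; apply: yT.
rewrite sumr_const card_ord -[ltLHS]mulr_natr mulrAC ltr_pdivrMr //.
by rewrite ltr_pM2l // ltr_nat.
Qed.

Lemma quadratic_bound : exists r K : R, [/\ 0 < r, 0 <= K &
  forall x i, enorm x < r -> `|G x i 0| <= K * \sum_j x j 0 ^+ 2].
Proof.
have [r [K [r0 K0 GK]]] := polynomial_expansion_coord G_exp (leqnn 2).
have [K' [K'0 GK']] := multilinear_bound (calG_lin (leqnn 2)) (isT : (0 < 2)%N).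
exists r, (K + K'); split=> // [|x i xr]; first by rewrite addr_ge0 // ltW.
have := GK x i xr; rewrite big_nat1 colD colN calG_diag // => h1.
have h2 := GK' x (enorm x) (coord_le_enorm x) i.
rewrite -enorm_sqr mulrDl -[G x i 0](subrK (calG (fun _ : 'I_2 => x) i 0)).
by rewrite (le_trans (ler_normD _ _)) // lerD.
Qed.

Variable mu : nat -> R.
Hypothesis mu_gt0 : forall k, 0 < mu k.
Hypothesis mu_incr : increasing_seq mu.
Hypothesis mu_add : forall a b, range mu a -> range mu b -> range mu (a + b).

(** Three errors add up: truncating the expansion of [G] at order [M], replacing [y] by the partial
    sum inside each [calG m], and the tuples whose exponent exceeds [mu N]. *)
Lemma nonlinear_remainder (y : R -> 'cV[R]_n) (eta : nat -> R -> 'cV[R]_n) N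
    (rho : R) :
  (forall e : R, 0 < e -> exists T, forall t i, T <= t -> `|y t i 0| <= e) ->
  (forall r i, r < mu 0%N -> decay r (fun t => y t i 0)) ->
  (forall j i, (j < N)%N -> SE (- mu j) (fun t => (eta j t i 0)%:C)) ->
  mu N < rho + mu 0%N ->
  (forall i, decay rho (fun t => (y t - \sum_(k < N) eta k t) i 0)) ->
  exists nu, mu N < nu /\ forall i, decay nu (fun t =>
    (G (y t) - \sum_(k < N.+1) resonant_sum calG mu eta k t) i 0).
Proof.
move=> ylim dy seta Nrho dw; have m0 := mu_gt0 0%N.
pose x0 := Num.max 0 (mu N - rho); pose r0 := (x0 + mu 0%N) / 2.
have x0m : x0 < mu 0%N by rewrite gt_max m0 ltrBlDl.
have [x00 x0N] : 0 <= x0 /\ mu N - rho <= x0.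
  by rewrite /x0 !le_max !lexx orbT.
have r00 : 0 < r0 by rewrite /r0; lra.
have r0m : r0 < mu 0%N by rewrite /r0; lra.
have r0N : mu N < rho + r0 by rewrite /r0; lra.
(* Large enough that a remainder of order [M] in [y] has rate [M%:R * r0] above [mu N]. *)
pose M := maxn 2 (Num.bound (mu N / r0)).
have M2 : (2 <= M)%N by apply: leq_maxl.
have MN : mu N < M%:R * r0.
  rewrite -ltr_pdivrMr //; have muN := mu_gt0 N.
  apply: (@lt_le_trans _ _ (Num.bound (mu N / r0))%:R).
    by apply: archi_boundP; rewrite divr_ge0 // ltW.
  by rewrite ler_nat leq_maxr.
have MN1 : mu N < M.+1%:R * mu 0%N.
  apply: lt_trans MN _; apply: (@lt_trans _ _ (M%:R * mu 0%N)).
    by rewrite ltr_pM2l // ltr0n ltnW.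
  by rewrite ltr_pM2r // ltr_nat.
have [nu3 [Nnu3 d3]] := nonresonant_decay mu_gt0 mu_incr mu_add calG_lin seta MN1.
have ds i : decay r0 (fun t => (\sum_(k < N) eta k t) i 0).
  apply: (decay_ext (decay_sum (index_enum 'I_N) (P := xpredT)
    (F := fun k t => eta k t i 0) (r := r0) _)) => [k _|t]; last by rewrite summxE.
  have rk : r0 < mu k by apply: lt_le_trans r0m _; rewrite mu_incr.
  exact: (SE_cdecay rk (seta k i (ltn_ord k))).1.
have dyr i := dy r0 i r0m.
have d2 i : decay (rho + r0) (fun t => \sum_(m <- index_iota 2 M.+1 | (2 <= m)%N)
    (calG (fun _ : 'I_m => y t) - calG (fun _ : 'I_m => \sum_(k < N) eta k t)) i 0).
  apply: decay_sum => m m2.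
  exact: (multilinear_diff_decay (calG_lin m2) m2 (ltW r00) dyr ds dw).
have d1 i : decay (M%:R * r0)
    (fun t => (G (y t) - \sum_(2 <= m < M.+1) Gm m (y t)) i 0).
  have [r [K [rr0 K0 GK]]] := polynomial_expansion_coord G_exp M2.
  have [T yT] := eventually_enorm_lt rr0 ylim.
  have dpow := decay_prod (fun _ : 'I_M => decay_enorm dyr).
  apply: (decay_le (T := T) (decayZ K dpow)) => t Tt.
  by rewrite prodr_const card_ord; apply: GK; apply: yT.
exists (Num.min (M%:R * r0) (Num.min (rho + r0) nu3)); split.
  by rewrite !lt_min MN r0N Nnu3.
move=> i.
have D : decay (Num.min (M%:R * r0) (Num.min (rho + r0) nu3)) (fun t =>
   (G (y t) - \sum_(2 <= m < M.+1) Gm m (y t)) i 0 +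
   (\sum_(m <- index_iota 2 M.+1 | (2 <= m)%N)
    (calG (fun _ : 'I_m => y t) - calG (fun _ : 'I_m => \sum_(k < N) eta k t)) i 0 +
   (\sum_(2 <= m < M.+1) calG (fun _ : 'I_m => \sum_(k < N) eta k t)
     - \sum_(k < N.+1) resonant_sum calG mu eta k t) i 0)).
  apply: decayD; first by apply: decay_weaken (d1 i); rewrite ge_min lexx.
  apply: decayD.
    by apply: decay_weaken (d2 i); rewrite !ge_min lexx orbT.
  by apply: decay_weaken (d3 i); rewrite !ge_min lexx !orbT.
apply: (decay_ext D) => t.
have -> : \sum_(m <- index_iota 2 M.+1 | (2 <= m)%N)
    (calG (fun _ : 'I_m => y t) - calG (fun _ : 'I_m => \sum_(k < N) eta k t)) i 0 =
  (\sum_(2 <= m < M.+1) Gm m (y t)) i 0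
  - (\sum_(2 <= m < M.+1) calG (fun _ : 'I_m => \sum_(k < N) eta k t)) i 0.
  rewrite !summxE -sumrB big_seq_cond [RHS]big_seq_cond; apply: eq_big => m.
    by rewrite mem_index_iota; case: (leqP 2 m).
  by move=> /andP[_ m2]; rewrite colD colN calG_diag.
by rewrite !colD !colN; ring.
Qed.

End Vectors.

Unset Implicit Arguments.

Theorem theorem10p5 (R : realType) (n : nat) (n_gt0 : (0 < n)%N)
    (A : 'M[R]_n)
    (A_pos : forall Lambda : R[i],
       eigenvalue (map_mx (real_complex R) A) Lambda -> 0 < complex.Re Lambda)
    (G : 'cV[R]_n -> 'cV[R]_n)
    (Gm : nat -> 'cV[R]_n -> 'cV[R]_n)
    (calG : forall m : nat, ('I_m -> 'cV[R]_n) -> 'cV[R]_n)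
    (G_lip : locally_lipschitz G)
    (Gm_homog : forall m, (2 <= m)%N -> homogeneous_polynomial m (Gm m))
    (G_exp : polynomial_expansion G Gm)
    (calG_lin : forall m, (2 <= m)%N -> multilinear (calG m))
    (calG_diag : forall m, (2 <= m)%N -> forall x, Gm m x = calG m (fun=> x))
    (f : R -> 'cV[R]_n)
    (f_cont : exists2 Tf : R, 0 <= Tf & {within `[Tf, +oo[, continuous f})
    (mu : nat -> R)
    (mu_gt0 : forall k, 0 < mu k)
    (mu_incr : increasing_seq mu)
    (mu_div : mu @ \oo --> +oo)
    (mu_add : forall a b, range mu a -> range mu b -> range mu (a + b))
    (mu_spec : forall Lambda : R[i],
       eigenvalue (map_mx (real_complex R) A) Lambda ->
       range mu (complex.Re Lambda))
    (fk : nat -> R -> 'cV[R]_n)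
    (fk_FE : forall k, FE_real (- mu k) (fk k))
    (f_exp : exp_expansion mu (@toCn R n \o f) (fun k => @toCn R n \o fk k))
    (T0 : R) (T0_ge0 : 0 <= T0)
    (y : R -> 'cV[R]_n)
    (y_der : forall t, T0 < t -> derivable y t 1)
    (y_C1 : forall t, T0 < t -> {for t, continuous (derive1 y)})
    (y_eq : forall t, T0 < t -> derive1 y t = - (A *m y t) + G (y t) + f t)
    (y_lim : y t @[t --> +oo] --> (0 : 'cV[R]_n)) :
  exists yk : nat -> R -> 'cV[R]_n,
    [/\ forall k, FE_real (- mu k) (yk k),
        exp_expansion mu (@toCn R n \o y) (fun k => @toCn R n \o yk k) &
        forall (k : nat) (t : R), derivable (yk k) t 1 /\
          derive1 (yk k) t + A *m yk k t = resonant_sum calG mu yk k t + fk k t].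
Proof.
have ylim := cvg0_coord y_lim.
have sf k i : SE (- mu k) (fun t => (fk k t i 0)%:C).
  by move/FE_realP: (fk_FE k); apply.
have df N : exists2 nu, mu N < nu & forall i,
    decay nu (fun t => (f t - \sum_(k < N.+1) fk k t) i 0).
  have [nu Nnu O] := f_exp.2 N; exists nu => //; apply/bigO_toCnP.
  have [T [K [T00 K00 fK]]] := O; exists T, K; split=> // t /fK.
  by rewrite /= toCn_subsum.
have eig0 L : eigenvalue (map_mx (real_complex R) A) L -> mu 0%N <= complex.Re L.
  by move=> /mu_spec[q _ <-]; rewrite mu_incr.
have y' i t : T0 + 1 <= t ->
    is_derive t 1 (fun t => y t i 0) ((- (A *m y t) + G (y t) + f t) i 0).
  move=> Tt; have tT0 : T0 < t by rewrite (lt_le_trans _ Tt) // ltrDl.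
  by rewrite -(y_eq t tT0); apply: is_derive_coord; apply: y_der.
have dy r i : r < mu 0%N -> decay r (fun t => y t i 0).
  (* The forcing needs a rate strictly above [r], while the first term of [f] only has rates below
     [mu 0]; hence a value in between. *)
  move=> rm; pose r' := (r + mu 0%N) / 2.
  have rr' : r < r' by rewrite /r'; lra.
  have r'm : r' < mu 0%N by rewrite /r'; lra.
  have [rad [K [rad0 K0 GK]]] := quadratic_bound G_exp calG_lin calG_diag.
  have [T1 yT1] := eventually_enorm_lt rad0 ylim.
  apply: (@initial_decay _ _ A (mu 0%N) r r' (Num.max (T0 + 1) T1) K y
    (G \o y) f) => // [j|t j|j t].
  - have [nu m0nu dfj] := df 0%N.
    have D1 := SE_cdecay r'm (sf 0%N j).
    have D2 := decay_weaken (ltW (lt_trans r'm m0nu)) (dfj j).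
    apply: (decay_ext (decayD D1.1 D2)) => t.
    by rewrite big_ord1 colD colN /=; ring.
  - by rewrite ge_max => /andP[_ T1t]; apply: GK; apply: yT1.
  by rewrite ge_max => /andP[Tt _]; apply: y'.
(* [N] counts the terms already found, of indices below [N]. The first bound on [rho] controls the
   nonlinear error; the second rules out homogeneous solutions of smaller rate and yields the final
   expansion. *)
pose P N (eta : nat -> R -> 'cV[R]_n) :=
  (forall k, (k < N)%N -> (forall i, SE (- mu k) (fun t => (eta k t i 0)%:C)) /\
    forall i (t : R), is_derive t 1 (fun t => eta k t i 0)
      ((resonant_sum calG mu eta k t + fk k t - A *m eta k t) i 0)) /\
  exists rho, [/\ mu N < rho + mu 0%N, forall k, (k < N)%N -> mu k < rho &
    forall i, decay rho (fun t => (y t - \sum_(k < N) eta k t) i 0)].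
have [yk Pyk] : exists yk, forall N, P N yk.
  apply: (@exists_sequence_of_extensions _ (fun=> 0)).
  - move=> N e e' ee' [He [rho [H1 H2 H3]]]; split=> [k kN|].
      have [S D] := He k kN; split=> [i|i t]; first by rewrite -ee'.
      rewrite -ee' // -(@resonant_sum_ext _ _ mu calG mu_gt0 mu_incr e) //.
      by move=> j jk; rewrite ee' // (ltn_trans jk).
    exists rho; split=> // i; apply: (decay_ext (H3 i)) => t.
    congr (fun_of_matrix (_ - _) i 0).
    by apply: eq_bigr => k _; rewrite ee'.
  (* With no term known, any [rho] strictly between 0 and [mu 0] is suitable. *)
  - split=> //; exists (mu 0%N / 2); have := mu_gt0 0%N.
    split=> // [|i]; first lra.
    have m2 : mu 0%N / 2 < mu 0%N by lra.
    apply: (decay_ext (dy _ i m2)) => t.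
    by rewrite big_ord0 subr0.
  move=> N eta [He [rho [Nrho krho dw]]].
  have seta j i : (j < N)%N -> SE (- mu j) (fun t => (eta j t i 0)%:C).
    by move=> /He[].
  have [nu1 [Nnu1 dG]] := nonlinear_remainder G_exp calG_lin calG_diag mu_gt0
    mu_incr mu_add ylim dy seta Nrho dw.
  have [nu2 Nnu2 dfN] := df N.
  pose w t := y t - \sum_(k < N) eta k t.
  pose J k t := resonant_sum calG mu eta k t.
  pose g t := J N t + fk N t.
  (* The sums in [h] include the index [N], whose contribution [g] restores; thus
     [w' = g + h - A w], and [g] is the right-hand side wanted for the new term. *)
  pose h t := (G (y t) - \sum_(k < N.+1) J k t) + (f t - \sum_(k < N.+1) fk k t).
  have [|||||i t Tt|yN [nu [Nnu sN yN' dN]]] :=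
    @linear_expansion R n A (mu N) (Num.min nu1 nu2) rho (T0 + 1) w g h.
  - by rewrite lt_min Nnu1.
  - move=> L /mu_spec[q _ <-]; have [qN|Nq] := ltnP q N; first by left; apply: krho.
    by right; rewrite mu_incr.
  - move=> i.
    have sJ := resonant_sum_SE mu_gt0 mu_incr calG_lin seta i.
    by apply: (SE_ext (SED sJ (sf N i))) => t; rewrite colD rmorphD.
  - move=> i; apply: (decay_ext (decayD (decay_weaken _ (dG i))
                                        (decay_weaken _ (dfN i)))) => [||t].
    + by rewrite ge_min lexx.
    + by rewrite ge_min lexx orbT.
    by rewrite /h [in RHS]colD.
  - exact: dw.
  - have dsum := der_sum (index_enum 'I_N) (P := xpredT)
      (fun (k : 'I_N) _ => (He k (ltn_ord k)).2 i t).
    have := derB (y' i t Tt) dsum.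
    have -> : (fun t => y t i 0 - \sum_(k < N) eta k t i 0) = (fun t => w t i 0).
      by apply/funext => s; rewrite colD colN summxE.
    move=> D; apply: (is_derive_eq D).
    have E : \sum_(k < N) (resonant_sum calG mu eta k t + fk k t - A *m eta k t) =
        \sum_(k < N) J k t + \sum_(k < N) fk k t - A *m \sum_(k < N) eta k t.
      by rewrite mulmx_sumr -big_split -sumrB.
    rewrite -summxE E /g /h /w mulmxBr !big_ord_recr /= !colD !colN !colD !colN.
    by ring.
  exists yN; split=> [k|].
    rewrite ltnS leq_eqVlt => /orP[/eqP ->|kN].
      rewrite eqxx; split=> // i t.
      rewrite -(@resonant_sum_ext _ _ mu calG mu_gt0 mu_incr eta) // => j jN.
      by rewrite (ltn_eqF jN).
    rewrite (ltn_eqF kN); have [S D] := He k kN; split=> // i t.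
    rewrite -(@resonant_sum_ext _ _ mu calG mu_gt0 mu_incr eta) // => j jk.
    by rewrite (ltn_eqF (ltn_trans jk kN)).
  exists nu; split.
  (* By closure [mu N + mu 0] is some [mu q] with [N < q], so
     [mu N.+1 <= mu N + mu 0 < nu + mu 0]. *)
  - have [||q _ qE] := mu_add (mu N) (mu 0%N); [by exists N|by exists 0%N|].
    apply: (@le_lt_trans _ _ (mu q)); last by rewrite qE ltrD2r.
    rewrite mu_incr -(mu_lt mu_incr) qE ltrDl.
    exact: mu_gt0.
  - by move=> k; rewrite ltnS => kN; apply: le_lt_trans Nnu; rewrite mu_incr.
  move=> i; apply: (decay_ext (dN i)) => t; congr (fun_of_matrix _ i 0).
  rewrite big_ord_recr /= eqxx opprD addrA; congr (_ - _ - _).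
  by apply: eq_bigr => k _; rewrite (ltn_eqF (ltn_ord k)).
exists yk; split.
- by move=> k; apply/FE_realP; have [/(_ k (ltnSn k))[]] := Pyk k.+1.
- split=> [k|N].
    have [/(_ k (ltnSn k))[S _] _] := Pyk k.+1.
    by have /FE_realP := S.
  have [_ [rho [_ krho D]]] := Pyk N.+1.
  exists rho; first exact: krho.
  have [T [K [T00 K00 yK]]] := (bigO_toCnP _ rho).2 D.
  by exists T, K; split=> // t /yK; rewrite /= toCn_subsum.
move=> k t; have [/(_ k (ltnSn k))[_ D] _] := Pyk k.+1.
have [d1 ->] := derive1_of_coord (fun i => D i t).
by split=> //; rewrite subrK.
Qed.
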